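(* Let $m,n\in\mathbb N$, let $D$ and $\widehat D$ be real diagonal $m\times m$ matrices and $B=\mathrm{diag}\{b_1,\dots,b_m\}$ with $b_k=\pm 1$. Let $A\in\mathbb C^{n\times n}$ have spectrum $\sigma(A)=\{0\}$, and let the initial potential be $\varrho\equiv 0$. Let $\Pi(x),S(x),\widetilde\varrho(x),w_A(x,z)$ (one-variable case) and $\Pi(x,t),S(x,t),\widetilde\varrho(x,t),w_A(x,t,z)$ (two-variable case) be the objects defined in the context, with $x,t\ge0$ and with $\widetilde\varrho$ and $w_A$ considered at the points where $S$ is invertible, and $z\in\mathbb C\setminus\{0\}$. Then: (1) $\Pi(x)$ and $S(x)$ are matrix polynomials in $x$, and $\Pi(x,t)$ and $S(x,t)$ are matrix polynomials in $x$ and $t$. (2) $\widetilde\varrho(x)=p(x)/\det S(x)$ and $\widetilde\varrho(x,t)=p(x,t)/\det S(x,t)$, where $p(x)$ is a matrix polynomial in $x$, $p(x,t)$ is a matrix polynomial in $x$ and $t$, $\det S(x)$ is a polynomial in $x$ and $\det S(x,t)$ is a polynomial in $x$ and $t$. (3) $w_A(x,z)=P(x,z)/\det S(x)$ and $w_A(x,t,z)=P(x,t,z)/\det S(x,t)$, where $P(x,z)$ is a matrix polynomial in $x$ and $1/z$, and $P(x,t,z)$ is a matrix polynomial in $x$, $t$ and $1/z$. (4) If $\det S(x)\ne 0$ for all $x\ge 0$, then the transformed fundamental solution $\widetilde w(x,z)$ is given by $$\widetilde w(x,z)=w_A(x,z)\,\mathrm e^{\mathrm i zxD}\,w_A(0,z)^{-1}.$$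 If $\det S(x,t)\neq0$ on a semi-band $0\le x<\infty$, $0\le t\le\varepsilon$, then the transformed wave function $\widetilde w(x,t,z)$ is given there by $$\widetilde w(x,t,z)=w_A(x,t,z)\,\mathrm e^{\mathrm i z(xD+t\widehat D)}\,w_A(0,0,z)^{-1}.$$ (Thus, they are expressed via matrix polynomials and exponentials of diagonal matrices.)
   Context: Notation: $[P,Q]:=PQ-QP$; $^*$ is the conjugate transpose; $I_k$ is the $k\times k$ identity; $\mathrm i$ is the imaginary unit. One-variable case. Fix $S(0)=S(0)^*\in\mathbb C^{n\times n}$ and $\Pi(0)\in\mathbb C^{n\times m}$ with $AS(0)-S(0)A^*=\mathrm i\,\Pi(0)B\Pi(0)^*$. For $\varrho\equiv0$, the matrix functions $\Pi(x)\in\mathbb C^{n\times m}$ and $S(x)\in\mathbb C^{n\times n}$ are determined by these initial values and $$\Pi_x=-\mathrm i A\Pi D,\qquad S_x=\Pi DB\Pi^*.$$ At points where $S(x)$ is invertible, put $$\widetilde\varrho(x)=-B\Pi(x)^*S(x)^{-1}\Pi(x),\qquad w_A(x,z)=I_m-\mathrm i B\Pi(x)^*S(x)^{-1}(A-zI_n)^{-1}\Pi(x).$$ The transformed fundamental solution $\widetilde w(x,z)$ is the $m\times m$ solution of $\widetilde w_x=(\mathrm i zD-[D,\widetilde\varrho\,])\widetilde w$ with $\widetilde w(0,z)=I_m$. Two-variable case. Fix $S(0,0)=S(0,0)^*\in\mathbb C^{n\times n}$ and $\Pi(0,0)\in\mathbb C^{n\times m}$ with $AS(0,0)-S(0,0)A^*=\mathrm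 i\,\Pi(0,0)B\Pi(0,0)^*$. For $\varrho\equiv0$, the matrix functions $\Pi(x,t)$ and $S(x,t)$ are determined by these initial values and $$\Pi_x=-\mathrm i A\Pi D,\quad \Pi_t=-\mathrm i A\Pi\widehat D,\quad S_x=\Pi DB\Pi^*,\quad S_t=\Pi\widehat DB\Pi^*.$$ At points where $S(x,t)$ is invertible, put $$\widetilde\varrho(x,t)=-B\Pi(x,t)^*S(x,t)^{-1}\Pi(x,t),$$ $$w_A(x,t,z)=I_m-\mathrm i B\Pi(x,t)^*S(x,t)^{-1}(A-zI_n)^{-1}\Pi(x,t).$$ The transformed wave function $\widetilde w(x,t,z)$ is the $m\times m$ matrix function satisfying $\widetilde w_x=(\mathrm i zD-[D,\widetilde\varrho\,])\widetilde w$, $\widetilde w_t=(\mathrm i z\widehat D-[\widehat D,\widetilde\varrho\,])\widetilde w$ and $\widetilde w(0,0,z)=I_m$. *)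

(* Defs.v *)
From HB Require Import structures.
From mathcomp Require Import all_boot all_order all_algebra.
From mathcomp Require Import complex.
From mathcomp Require Import all_classical all_reals all_analysis.

Set Implicit Arguments.
Unset Strict Implicit.
Unset Printing Implicit Defensive.

Import Order.TTheory GRing.Theory Num.Theory.
Import numFieldNormedType.Exports.

Local Open Scope classical_set_scope.
Local Open Scope complex_scope.
Local Open Scope sesquilinear_scope.
Local Open Scope ring_scope.

Section Defs.
Context {R : realType}.
Local Notation C := R[i].

Definition rdiag m (d : 'rV[R]_m) : 'M[C]_m := diag_mx (map_mx (real_complex R) d).

Definition commutator m (P Q : 'M[C]_m) : 'M[C]_m := P *m Q - Q *m P.

(* F has derivative L at x relative to D (one-sided at the end points of an
   interval D); the limit is entrywise, in the norm topology of the field C,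
   which the library attaches to the regular module C^o. *)
Definition deriv_within (D : set R) p q (F : R -> 'M[C]_(p, q)) (x : R)
    (L : 'M[C]_(p, q)) : Prop :=
  forall i j,
    ((fun y : R => (F y i j - F x i j) / (y - x)%:C : C^o) @ within D x^')
      --> (L i j : C^o).

Definition mxexp m (M : 'M[C]_m) : 'M[C]_m :=
  \matrix_(i, j) limn (series (fun k : nat => (M ^+ k) i j / (k`!)%:R : C^o)).

(* Evaluation, entry by entry, of matrix polynomials in one, two and three
   variables; in {poly {poly C}} the first variable is the outermost one. *)
Definition mxeval1 p q (P : 'M[{poly C}]_(p, q)) (x : C) : 'M[C]_(p, q) :=
  \matrix_(i, j) (P i j).[x].

Definition mxeval2 p q (P : 'M[{poly {poly C}}]_(p, q)) (x y : C) :
    'M[C]_(p, q) :=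
  \matrix_(i, j) (P i j).[x%:P].[y].

Definition mxeval3 p q (P : 'M[{poly {poly {poly C}}}]_(p, q)) (x y u : C) :
    'M[C]_(p, q) :=
  \matrix_(i, j) (P i j).[x%:P%:P].[y%:P].[u].

Definition rho_tilde m n (B : 'M[C]_m) (Pi : 'M[C]_(n, m)) (S : 'M[C]_n) :
    'M[C]_m :=
  - (B *m Pi^t* *m invmx S *m Pi).

Definition darboux m n (A : 'M[C]_n) (B : 'M[C]_m) (Pi : 'M[C]_(n, m))
    (S : 'M[C]_n) (z : C) : 'M[C]_m :=
  1%:M - 'i%C *: (B *m Pi^t* *m invmx S *m invmx (A - z%:M) *m Pi).

Definition admissible_init m n (A : 'M[C]_n) (B : 'M[C]_m)
    (Pi0 : 'M[C]_(n, m)) (S0 : 'M[C]_n) : Prop :=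
  S0^t* = S0 /\ A *m S0 - S0 *m A^t* = 'i%C *: (Pi0 *m B *m Pi0^t*).

Definition system1 m n (A : 'M[C]_n) (B D : 'M[C]_m)
    (Pi : R -> 'M[C]_(n, m)) (S : R -> 'M[C]_n) : Prop :=
  forall x, 0 <= x ->
    deriv_within [set y | 0 <= y] Pi x (- ('i%C *: (A *m Pi x *m D))) /\
    deriv_within [set y | 0 <= y] S x (Pi x *m D *m B *m (Pi x)^t*).

Definition system2 m n (A : 'M[C]_n) (B D Dh : 'M[C]_m)
    (Pi : R -> R -> 'M[C]_(n, m)) (S : R -> R -> 'M[C]_n) : Prop :=
  (forall t, 0 <= t -> system1 A B D (Pi^~ t) (S^~ t)) /\
  (forall x, 0 <= x -> system1 A B Dh (Pi x) (S x)).

Definition fundamental_solution m (D : 'M[C]_m) (rho : R -> 'M[C]_m) (z : C)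
    (W : R -> 'M[C]_m) : Prop :=
  W 0 = 1%:M /\
  forall x, 0 <= x ->
    deriv_within [set y | 0 <= y] W x
      (('i%C * z *: D - commutator D (rho x)) *m W x).

Definition wave_function m (D Dh : 'M[C]_m) (rho : R -> R -> 'M[C]_m)
    (eps : R) (z : C) (W : R -> R -> 'M[C]_m) : Prop :=
  W 0 0 = 1%:M /\
  forall x t, 0 <= x -> 0 <= t <= eps ->
    deriv_within [set y | 0 <= y] (W^~ t) x
      (('i%C * z *: D - commutator D (rho x t)) *m W x t) /\
    deriv_within [set s | 0 <= s <= eps] (W x) t
      (('i%C * z *: Dh - commutator Dh (rho x t)) *m W x t).

End Defs.

(* Main.v *)
Require Import Defs.
From HB Require Import structures.
From mathcomp Require Import all_boot all_order all_algebra.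
From mathcomp Require Import complex.
From mathcomp Require Import all_classical all_reals all_analysis.
From mathcomp Require Import ring lra.

Set Implicit Arguments.
Unset Strict Implicit.
Unset Printing Implicit Defensive.

Import Order.TTheory GRing.Theory Num.Theory.
Import numFieldNormedType.Exports.

Local Open Scope classical_set_scope.
Local Open Scope complex_scope.
Local Open Scope ring_scope.

(** Since the only eigenvalue of [A] is [0], the matrix [A] is nilpotent
    ([nilpotent_eigenvalue]), and everything explicit follows from that.

    The derivative of [A ^+ k *m Pi] is a multiple of [A ^+ k.+1 *m Pi], and
    [A ^+ n = 0]; integrating [n] times, with [k] going down from [n] to [0], shows
    that [Pi] is a polynomial ([nilpotent_polymx]).  Then [S] is the integral of
    a polynomial.  In two variables one integrates in [x] at fixed [t], the
    constant of integration being the one-variable solution on the edge [x = 0]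
    ([integral_polymx2]).  By Cramer's rule the inverse of [S] is a polynomial
    divided by [\det S], which gives the form of [rho]; the resolvent
    [(A - z)^-1] is a finite Neumann series in [1 / z], which gives that of the
    Darboux matrix [w] ([darboux_polymx]).

    For the last part, the identity [A S - S A^* = i Pi B Pi^*] is conserved by
    the system ([node_identity_propagates]).  It makes [w] invertible
    ([darboux_mul_inverse]) and it turns the derivative of [w] into
    [w' = (i z D - [D, rho]) w - i z w D] ([darboux_deriv]).  So [w E c]
    satisfies the transformed system when [E] is the exponential with
    [E' = i z D E] and [c] is constant ([dressed_deriv]).  Conversely, if [W]
    satisfies it, then [E^-1 w^-1 W] has derivative zero and is constant
    ([undressed_const]); the value at the origin determines the constant.  In
    two variables this is done along [x] and [t] in turn.

    Two analytic facts support this: a complex matrix function on an interval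
    whose derivative vanishes, one-sidedly at the end points, is constant
    ([deriv0_eq]); and the exponential series of a diagonal complex matrix
    converges and has the expected derivative ([cexp_deriv], [mxexp_diag]), which
    comes from differentiating its real and imaginary parts as real power
    series. *)

(** * Limits of scalars and matrices *)

Definition clim (K : numFieldType) T (F : set_system T) (f : T -> K) (l : K) :
    Prop :=
  (f : T -> K^o) @ F --> (l : K^o).

Definition mxlim (K : numFieldType) T (F : set_system T) p q
    (f : T -> 'M[K]_(p, q)) (L : 'M[K]_(p, q)) : Prop :=
  forall i j, clim F (fun y => f y i j) (L i j).

Section Limits.
Context (K : numFieldType) (T : Type) (F : set_system T) {FF : Filter F}.
Implicit Types (f g : T -> K) (a b : K).

Lemma clim_cst a : clim F (fun=> a) a.
Proof. exact: cvg_cst. Qed.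

Lemma climD f g a b :
  clim F f a -> clim F g b -> clim F (fun y => f y + g y) (a + b).
Proof. by move=> hf hg; apply: cvgD. Qed.

Lemma climN f a : clim F f a -> clim F (fun y => - f y) (- a).
Proof. by move=> hf; apply: cvgN. Qed.

Lemma climM f g a b :
  clim F f a -> clim F g b -> clim F (fun y => f y * g y) (a * b).
Proof. by move=> hf hg; apply: cvgM. Qed.

Lemma climV f a : a != 0 -> clim F f a -> clim F (fun y => (f y)^-1) a^-1.
Proof. by move=> a0 hf; apply: cvgV. Qed.

Lemma clim_near f g a : (\forall y \near F, f y = g y) ->
  clim F f a -> clim F g a.
Proof.
move=> hfg hf; apply: cvg_trans hf; apply: near_eq_cvg.
by apply: filterS hfg.
Qed.

Lemma clim_sum I (r : seq I) (f : I -> T -> K) (a : I -> K) :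
  (forall i, clim F (f i) (a i)) ->
  clim F (fun y => \sum_(i <- r) f i y) (\sum_(i <- r) a i).
Proof.
move=> hf; elim: r => [|i r IH].
  rewrite big_nil; under eq_fun do rewrite big_nil; exact: clim_cst.
by rewrite big_cons; under eq_fun do rewrite big_cons; exact: climD.
Qed.

Lemma clim_prod I (r : seq I) (f : I -> T -> K) (a : I -> K) :
  (forall i, clim F (f i) (a i)) ->
  clim F (fun y => \prod_(i <- r) f i y) (\prod_(i <- r) a i).
Proof.
move=> hf; elim: r => [|i r IH].
  rewrite big_nil; under eq_fun do rewrite big_nil; exact: clim_cst.
by rewrite big_cons; under eq_fun do rewrite big_cons; exact: climM.
Qed.

Lemma mxlim_cst p q (L : 'M[K]_(p, q)) : mxlim F (fun=> L) L.
Proof. by move=> i j; apply: clim_cst. Qed.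

Lemma mxlim_near p q (f g : T -> 'M[K]_(p, q)) L :
  (\forall y \near F, f y = g y) -> mxlim F f L -> mxlim F g L.
Proof.
move=> hfg hf i j; apply: clim_near (hf i j).
by apply: filterS hfg => y ->.
Qed.

Lemma mxlimD p q (f g : T -> 'M[K]_(p, q)) L M :
  mxlim F f L -> mxlim F g M -> mxlim F (fun y => f y + g y) (L + M).
Proof.
move=> hf hg i j; rewrite mxE; under eq_fun do rewrite mxE; exact: climD.
Qed.

Lemma mxlimN p q (f : T -> 'M[K]_(p, q)) L :
  mxlim F f L -> mxlim F (fun y => - f y) (- L).
Proof.
move=> hf i j; rewrite mxE; under eq_fun do rewrite mxE; exact: climN.
Qed.

Lemma mxlimZ p q (c : T -> K) (f : T -> 'M[K]_(p, q)) a L :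
  clim F c a -> mxlim F f L -> mxlim F (fun y => c y *: f y) (a *: L).
Proof.
move=> hc hf i j; rewrite mxE; under eq_fun do rewrite mxE; exact: climM.
Qed.

Lemma mxlim_scalar n f a :
  clim F f a -> mxlim F (fun y => (f y)%:M : 'M[K]_n) a%:M.
Proof.
move=> hf i j; rewrite mxE; under eq_fun do rewrite mxE.
by case: (i == j); [exact: hf | exact: clim_cst].
Qed.

Lemma mxlimM p q r (f : T -> 'M[K]_(p, q)) (g : T -> 'M[K]_(q, r)) L M :
  mxlim F f L -> mxlim F g M -> mxlim F (fun y => f y *m g y) (L *m M).
Proof.
move=> hf hg i j; rewrite mxE; under eq_fun do rewrite mxE.
by apply: clim_sum => k; exact: climM.
Qed.

Lemma clim_det n (f : T -> 'M[K]_n) L :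
  mxlim F f L -> clim F (fun y => \det (f y)) (\det L).
Proof.
move=> hf; apply: clim_sum => s; apply: climM; first exact: clim_cst.
by apply: clim_prod => i.
Qed.

Lemma mxlim_adj n (f : T -> 'M[K]_n) L :
  mxlim F f L -> mxlim F (fun y => \adj (f y)) (\adj L).
Proof.
move=> hf i j; rewrite mxE; under eq_fun do rewrite mxE.
apply: climM; first exact: clim_cst.
apply: clim_det => k l; rewrite !mxE.
by under eq_fun do rewrite !mxE; exact: hf.
Qed.

(** Cramer's rule expresses the inverse by the determinant and the adjugate,
    which are continuous. *)
Lemma mxlim_inv n (f : T -> 'M[K]_n) L :
  L \in unitmx -> (\forall y \near F, f y \in unitmx) ->
  mxlim F f L -> mxlim F (fun y => invmx (f y)) (invmx L).
Proof.
move=> uL uf hf.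
apply: (@mxlim_near _ _ (fun y => (\det (f y))^-1 *: \adj (f y))).
  by apply: filterS uf => y uy; rewrite /invmx uy.
rewrite /invmx uL; apply: mxlimZ; last exact: mxlim_adj.
by apply: climV; [rewrite -unitfE -unitmxE | exact: clim_det].
Qed.

End Limits.

(** * Derivatives of complex matrix functions along a set of reals *)

Lemma climP (K : numFieldType) T (F : set_system T) (FF : Filter F)
    (f : T -> K) (l : K) :
  clim F f l <-> forall e, 0 < e -> \forall y \near F, `|l - f y| < e.
Proof. exact: cvgrPdist_lt. Qed.

Section Derivatives.
Variable R : realType.
Local Notation C := R[i].
Implicit Types (D : set R) (x y : R).

Lemma normc_real x : `|x%:C| = `|x|%:C.
Proof. by rewrite normc_def /= expr0n addr0 sqrtr_sqr. Qed.

Lemma normc_ge_Im (z : C) : `|complex.Im z|%:C <= `|z|.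
Proof.
by have := normc_ge_Re (z * 'i%C); rewrite ReiNIm normrN normrM complexiE normCi mulr1.
Qed.

Lemma gt0_real (e : C) : 0 < e -> exists2 r : R, 0 < r & e = r%:C.
Proof.
move=> e0; exists (complex.Re e); last by rewrite RRe_real // gtr0_real.
by move: e0; rewrite ltcE => /andP[].
Qed.

Lemma clim_realP T (F : set_system T) (FF : Filter F) (f : T -> C) (l : C) :
  clim F f l <->
  forall e : R, 0 < e -> \forall y \near F, `|l - f y| < e%:C.
Proof.
split=> [/climP h e e0|h]; first by apply: h; rewrite ltcR.
by apply/climP => e /gt0_real[r r0 ->]; apply: h.
Qed.

Definition slope p q (F : R -> 'M[C]_(p, q)) x y : 'M[C]_(p, q) :=
  (y - x)%:C^-1 *: (F y - F x).

Lemma deriv_slopeP D p q (F : R -> 'M[C]_(p, q)) x L :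
  deriv_within D F x L <-> mxlim (within D x^') (slope F x) L.
Proof.
split=> h i j; have {h} := h i j; rewrite -/(clim _ _ _);
  by apply: clim_near; apply: nearW => y; rewrite !mxE mulrC.
Qed.

Lemma near_within_neq D x : \forall y \near within D x^', D y /\ y != x.
Proof.
rewrite near_withinE /= near_withinE; apply: nearW => y yx Dy.
by split.
Qed.

Lemma clim_sub0 D x : clim (within D x^') (fun y => (y - x)%:C : C) 0.
Proof.
apply/clim_realP => e e0.
have h : \forall y \near x, `|x - y| < e by apply/nbhs_ballP; exists e.
 rewrite near_withinE /= near_withinE.
apply: filterS h => y + _ _.
by rewrite sub0r normrN normc_real ltcR distrC. Qed.

Lemma deriv_lim D p q (F : R -> 'M[C]_(p, q)) x L :
  deriv_within D F x L -> mxlim (within D x^') F (F x).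
Proof.
move/deriv_slopeP => h.
apply: (@mxlim_near _ _ _ _ _ _ (fun y => F x + (y - x)%:C *: slope F x y)).
  apply: filterS (near_within_neq D x) => y [_ yx].
  have yx0 : (y - x)%:C != 0 :> C by rewrite (inj_eq (@complexI R)) subr_eq0.
  by rewrite /slope scalerA (divff yx0) scale1r addrC subrK.
rewrite -[X in mxlim _ _ X]addr0 -[X in _ + X](scale0r L).
apply: mxlimD; first exact: mxlim_cst.
by apply: mxlimZ => //; exact: clim_sub0.
Qed.

Lemma deriv_ext D p q (F G : R -> 'M[C]_(p, q)) x L :
  D x -> (forall y, D y -> F y = G y) ->
  deriv_within D F x L -> deriv_within D G x L.
Proof.
move=> Dx FG /deriv_slopeP h; apply/deriv_slopeP.
apply: mxlim_near h; apply: filterS (near_within_neq D x) => y [Dy _].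
by rewrite /slope !FG.
Qed.

Lemma deriv_sub D D' p q (F : R -> 'M[C]_(p, q)) x L :
  D' `<=` D -> deriv_within D F x L -> deriv_within D' F x L.
Proof.
move=> sD h i j; apply: cvg_trans (h i j).
by apply: cvg_app; apply: within_subset.
Qed.

Lemma deriv_cst D p q (L : 'M[C]_(p, q)) x : deriv_within D (fun=> L) x 0.
Proof.
apply/deriv_slopeP; apply: (@mxlim_near _ _ _ _ _ _ (fun=> 0)).
  by apply: nearW => y; rewrite /slope subrr scaler0.
exact: mxlim_cst.
Qed.

Lemma derivD D p q (F G : R -> 'M[C]_(p, q)) x L M :
  deriv_within D F x L -> deriv_within D G x M ->
  deriv_within D (fun y => F y + G y) x (L + M).
Proof.
move=> /deriv_slopeP hF /deriv_slopeP hG; apply/deriv_slopeP.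
apply: mxlim_near (mxlimD hF hG); apply: nearW => y.
by rewrite /slope -scalerDr addrACA -opprD.
Qed.

Lemma derivN D p q (F : R -> 'M[C]_(p, q)) x L :
  deriv_within D F x L -> deriv_within D (fun y => - F y) x (- L).
Proof.
move=> /deriv_slopeP hF; apply/deriv_slopeP.
apply: mxlim_near (mxlimN hF); apply: nearW => y.
by rewrite /slope -scalerN opprD.
Qed.

Lemma derivZ D p q (c : C) (F : R -> 'M[C]_(p, q)) x L :
  deriv_within D F x L -> deriv_within D (fun y => c *: F y) x (c *: L).
Proof.
move=> /deriv_slopeP hF; apply/deriv_slopeP.
apply: mxlim_near (mxlimZ (@clim_cst _ _ (within D x^') _ c) hF); apply: nearW => y.
by rewrite /slope -scalerBr !scalerA mulrC.
Qed.

Lemma derivM D p q r (F : R -> 'M[C]_(p, q)) (G : R -> 'M[C]_(q, r)) x L M :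
  deriv_within D F x L -> deriv_within D G x M ->
  deriv_within D (fun y => F y *m G y) x (L *m G x + F x *m M).
Proof.
move=> /deriv_slopeP hF hG; have cG := deriv_lim hG.
move/deriv_slopeP: hG => hG; apply/deriv_slopeP.
apply: mxlim_near (mxlimD (mxlimM hF cG)
  (mxlimM (@mxlim_cst _ _ (within D x^') _ _ _ (F x)) hG)).
apply: nearW => y.
rewrite /slope -scalemxAl -scalemxAr -scalerDr mulmxBl mulmxBr.
by rewrite addrA subrK.
Qed.

(** The difference quotient of an inverse is
    [- F y ^-1 * slope * F x ^-1], so continuity of the inverse suffices. *)
Lemma deriv_inv D n (F : R -> 'M[C]_n) x L :
  D x -> (forall y, D y -> F y \in unitmx) ->
  deriv_within D F x L ->
  deriv_within D (fun y => invmx (F y)) x (- (invmx (F x) *m L *m invmx (F x))).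
Proof.
move=> Dx uF hF; have cF := deriv_lim hF.
move/deriv_slopeP: hF => hF; apply/deriv_slopeP.
have nD := near_within_neq D x.
have cI : mxlim (within D x^') (fun y => invmx (F y)) (invmx (F x)).
  apply: mxlim_inv cF; first exact: uF.
  by apply: filterS nD => y [Dy _]; apply: uF.
apply: mxlim_near (mxlimN (mxlimM (mxlimM cI hF)
  (@mxlim_cst _ _ (within D x^') _ _ _ (invmx (F x))))).
apply: filterS nD => y [Dy _].
have vy : invmx (F y) *m F y = 1%:M by apply: mulVmx; apply: uF.
have vx : F x *m invmx (F x) = 1%:M by apply: mulmxV; apply: uF.
rewrite /slope -scalemxAr -scalemxAl -scalerN; congr (_ *: _).
by rewrite mulmxBr mulmxBl vy mul1mx -mulmxA vx mulmx1 opprB.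
Qed.

Lemma deriv_adj D p q (F : R -> 'M[C]_(p, q)) x L :
  deriv_within D F x L ->
  deriv_within D (fun y => ((F y)^t*)%sesqui) x (L^t*)%sesqui.
Proof.
move=> hF i j; have := hF j i; rewrite -!/(clim _ _ _).
move=> /climP h; apply/climP => e /h; apply: filterS => y.
rewrite !mxE; set z := (X in `|X| < e -> _); set w := (X in _ -> `|X| < e).
have -> : w = (z^*)%R; last by rewrite norm_conjC.
have yx_real : ((y - x)%:C^*)%R = (y - x)%:C :> C by exact: conjc_real.
rewrite /w /z; move: ((y - x)%:C) yx_real => r rK.
by rewrite rmorphB rmorphM fmorphV rmorphB /= rK.
Qed.

(** The derivatives are one-sided at the end points of [D].  Composing [F] with
    the projection of the line onto [[a, b]], which is 1-Lipschitz, gives a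
    function whose two-sided derivative vanishes on the whole line. *)
Lemma deriv0_eq D p q (F : R -> 'M[C]_(p, q)) a b :
  a <= b -> (forall y, a <= y <= b -> D y) ->
  (forall y, a <= y <= b -> deriv_within D F y 0) -> F a = F b.
Proof.
move=> ab sD hF.
pose c y := Num.max a (Num.min b y).
have cab y : a <= c y <= b.
  by rewrite /c le_max lexx ge_max ab ge_min lexx.
have ca : c a = a by rewrite /c min_r // maxxx.
have cb : c b = b by rewrite /c minxx max_r.
have c_lip x y : `|c y - c x| <= `|y - x|.
  rewrite ler_norml /c.
  have := ler_norm (y - x); have := ler_norm (x - y); rewrite (distrC x y).
  case: (leP b y) => hy; case: (leP b x) => hx; rewrite ?(max_r ab);
    try (case: (leP a y) => ay); try (case: (leP a x) => ax);
    by move=> h1 h2; apply/andP; split; lra.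
have small i j (e : R) x : 0 < e ->
    \forall y \near x,
      `|F (c y) i j - F (c x) i j| <= (e * `|y - x|)%:C :> C.
  move=> e0; have := hF _ (cab x) i j; rewrite -/(clim _ _ _).
  move/clim_realP => /(_ _ e0); rewrite near_withinE /= near_withinE.
  move/nbhs_ballP => [d /= d0 hd].
  apply/nbhs_ballP; exists d => //= y hy.
  have [->|cxy] := eqVneq (c y) (c x).
    rewrite subrr normr0 lecR; apply: mulr_ge0; [exact: ltW|exact: normr_ge0].
  have hy' : ball (c x) d (c y).
    move: hy; rewrite /ball /= => hy; apply: le_lt_trans hy.
    by rewrite distrC (distrC x).
  have := hd _ hy' cxy (sD _ (cab y)).
  rewrite mxE sub0r normrN normrM normfV normc_real => /ltW.
  rewrite ler_pdivrMr; last by rewrite ltcR normr_gt0 subr_eq0.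
  move=> h; apply: le_trans h _.
  by rewrite -rmorphM lecR; apply: ler_wpM2l (ltW e0) _ _ _.
have const (g : C -> R) i j : (forall u v, g (u - v) = g u - g v) ->
    (forall z, `|g z|%:C <= `|z|) -> g (F a i j) = g (F b i j).
  move=> gB gN; rewrite -{1}ca -{1}cb.
  apply: (@is_derive_0_is_cst R (fun y => g (F (c y) i j))) => x.
  apply/is_derive1_caratheodory.
  pose G y := if y == x then 0 else (g (F (c y) i j) - g (F (c x) i j)) / (y - x).
  exists G; split; last by rewrite /G eqxx.
    move=> y; rewrite /G; case: eqVneq => [->|yx]; first by rewrite !subrr mulr0.
    by rewrite divfK // subr_eq0.
  apply/cvgrPdist_le => e e0; apply: filterS (small i j e x e0) => y hy.
  rewrite /G eqxx sub0r normrN; case: eqVneq => [_|yx].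
    by rewrite normr0 ltW.
  rewrite normrM normfV ler_pdivrMr; last by rewrite normr_gt0 subr_eq0.
  by rewrite -gB -lecR; apply: le_trans (gN _) hy.
apply/matrixP => i j; apply/eqP; rewrite eq_complex; apply/andP; split; apply/eqP.
  by apply: (const (@complex.Re R)) => [u v|z]; [rewrite raddfB|exact: normc_ge_Re].
by apply: (const (@complex.Im R)) => [u v|z]; [rewrite raddfB|exact: normc_ge_Im].
Qed.

End Derivatives.

(** * The complex exponential *)

Lemma clim_limn (K : numFieldType) (u : nat -> K) (l : K) :
  clim \oo u l -> limn (u : nat -> K^o) = l.
Proof. by move=> h; apply: cvg_lim h; apply: norm_hausdorff. Qed.

Lemma clim_unique (K : numFieldType) (u : nat -> K) (l l' : K) :
  clim \oo u l -> clim \oo u l' -> l = l'.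
Proof. by move=> /clim_limn <- /clim_limn. Qed.

Section Exponential.
Variable R : realType.
Local Notation C := R[i].

Definition cexp (w : C) : C :=
  limn (series (fun k : nat => w ^+ k / (k`!)%:R : C^o)).

Lemma clim_real T (F : set_system T) (FF : Filter F) (f : T -> R) (l : R) :
  f @ F --> l -> clim F (fun y => (f y)%:C : C) l%:C.
Proof.
move=> /cvgrPdist_lt h; apply/clim_realP => e /h; apply: filterS => y hy.
by rewrite -rmorphB normc_real ltcR.
Qed.

(** Coefficients of the real part of [d * exp (c x)] as a power series in the
    real variable [x].  The factor [d] is there because term-by-term
    differentiation replaces it by [d * c], and because [Im w = Re (- i w)] gives
    the imaginary part the same form. *)
Definition re_coef (c d : C) (k : nat) : R := complex.Re (d * c ^+ k) / (k`!)%:R.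

(** Comparison with the exponential series at [`|c| * `|x|]. *)
Lemma re_coef_cvg c d x : cvgn (pseries (re_coef c d) x).
Proof.
apply: normed_cvg.
have [r r0 rE] : exists2 r : R, 0 <= r & `|c| = r%:C.
  by exists (complex.Re `|c|); [have := normr_ge0 c; rewrite lecE => /andP[]
    | rewrite RRe_real // normr_real].
have [s s0 sE] : exists2 r : R, 0 <= r & `|d| = r%:C.
  by exists (complex.Re `|d|); [have := normr_ge0 d; rewrite lecE => /andP[]
    | rewrite RRe_real // normr_real].
apply: (@series_le_cvg _ _ (s *: exp_coeff (r * `|x|))) => [k|k|k|].
- exact: normr_ge0.
- by rewrite /= mulr_ge0 // divr_ge0 // exprn_ge0 // mulr_ge0.
- have reE : `|complex.Re (d * c ^+ k)| <= s * r ^+ k.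
    rewrite -lecR; have -> : (s * r ^+ k)%:C = `|d * c ^+ k|.
      by rewrite rmorphM rmorphXn /= -sE -rE normrM normrX.
    exact: normc_ge_Re.
  rewrite [leRHS](_ : _ = s * r ^+ k / (k`!)%:R * `|x| ^+ k); last first.
    transitivity (s * ((r * `|x|) ^+ k / (k`!)%:R)) => //.
    by rewrite exprMn; ring.
  rewrite /re_coef /= !normrM normfV normr_nat normrX.
  by rewrite ler_wpM2r ?exprn_ge0 // ler_wpM2r ?invr_ge0.
- by apply: is_cvg_seriesZ; exact: is_cvg_series_exp_coeff.
Qed.

Lemma re_coef_diffs c d : pseries_diffs (re_coef c d) = re_coef c (d * c).
Proof.
apply/funext => k; rewrite /pseries_diffs /re_coef factS natrM invfM.
by rewrite mulrCA mulVKf ?pnatr_eq0 // exprS mulrA.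
Qed.

Definition re_exp (c d : C) (x : R) : R := limn (pseries (re_coef c d) x).

Lemma re_exp_deriv (c d : C) (x : R) :
  is_derive x 1 (re_exp c d) (re_exp c (d * c) x).
Proof.
rewrite /re_exp -re_coef_diffs.
apply: (@pseries_snd_diffs _ _ (`|x| + 1)); rewrite ?re_coef_diffs;
  try exact: re_coef_cvg.
rewrite [ltRHS]ger0_norm ?addr_ge0 //; lra.
Qed.

Lemma cexp_lim (c d : C) (x : R) :
  clim \oo (fun n => d * \sum_(0 <= k < n) (c * x%:C) ^+ k / (k`!)%:R)
    ((re_exp c d x)%:C + 'i%C * (re_exp c (- ('i%C * d)) x)%:C).
Proof.
have h e : clim \oo (fun n => (pseries (re_coef c e) x n)%:C : C)
    (re_exp c e x)%:C by apply: clim_real; exact: re_coef_cvg.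
have hi : clim \oo (fun=> 'i%C : C) 'i%C by exact: clim_cst.
apply: clim_near (climD (h d) (climM hi (h (- ('i%C * d))))).
apply: nearW => n; rewrite /pseries /series /= !rmorph_sum /= !mulr_sumr.
rewrite -big_split /=; apply: eq_bigr => k _.
rewrite /re_coef exprMn !rmorphM !fmorphV !rmorph_nat -!rmorphXn /=.
have -> : complex.Re (- ('i%C * d) * c ^+ k) = complex.Im (d * c ^+ k).
  by rewrite mulNr raddfN /= -mulrA mulrC ReiNIm opprK.
rewrite !mulrA -mulrDl -mulrDl -complexE; ring.
Qed.

Arguments cexp_lim : clear implicits.

Lemma cexpE (c d : C) (x : R) : d * cexp (c * x%:C) =
  (re_exp c d x)%:C + 'i%C * (re_exp c (- ('i%C * d)) x)%:C.
Proof.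
apply: clim_unique (cexp_lim c d x).
have hd : clim \oo (fun=> d : C) d by exact: clim_cst.
apply: climM hd _; have e1 := cexp_lim c 1 x.
rewrite /cexp (clim_limn (u := series _) (clim_near _ e1)).
  by apply: clim_near e1; apply: nearW => n; rewrite mul1r.
by apply: nearW => n; rewrite mul1r.
Qed.

Lemma re_exp_slope D (c d : C) (x : R) :
  clim (within D x^')
    (fun y => ((re_exp c d y - re_exp c d x) / (y - x))%:C : C)
    (re_exp c (d * c) x)%:C.
Proof.
have /is_derive1_caratheodory[g [gE gC <-]] := re_exp_deriv c d x.
apply: clim_real.
have : g y @[y --> within D x^'] --> g x.
  by apply: cvg_within_filter; apply: cvg_within_filter; exact: gC.
apply: cvg_trans; apply: near_eq_cvg.
apply: filterS (near_within_neq D x) => y [_ yx].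
by rewrite gE mulfK // subr_eq0.
Qed.

Lemma cexp_deriv D (c : C) (x : R) :
  deriv_within D (fun y => (cexp (c * y%:C))%:M : 'M[C]_1) x
    (c * cexp (c * x%:C))%:M.
Proof.
have hi : clim (within D x^') (fun=> 'i%C : C) 'i%C by exact: clim_cst.
have h : clim (within D x^')
    (fun y => (cexp (c * y%:C) - cexp (c * x%:C)) / (y - x)%:C)
    (c * cexp (c * x%:C)).
  have eC : c * cexp (c * x%:C) = (re_exp c (1 * c) x)%:C +
      'i%C * (re_exp c (- ('i%C * 1) * c) x)%:C.
    by rewrite cexpE mul1r mulr1 mulNr.
  rewrite eC; apply: clim_near (climD (@re_exp_slope D c 1 x)
    (climM hi (@re_exp_slope D c (- ('i%C * 1)) x))).
  apply: nearW => y.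
  rewrite -[cexp (c * y%:C)]mul1r -[cexp (c * x%:C)]mul1r !cexpE.
  rewrite !rmorphM !fmorphV !rmorphB /=; ring.
apply/deriv_slopeP; apply: mxlim_near (@mxlim_scalar _ _ _ _ 1 _ _ h); apply: nearW => y.
by rewrite /slope -raddfB scale_scalar_mx mulrC.
Qed.

Lemma cexp0 : cexp 0 = 1.
Proof.
apply: clim_limn; have h1 : clim \oo (fun=> 1 : C) 1 by exact: clim_cst.
apply: clim_near h1; exists 1%N => // -[//|n] _.
rewrite /series /= big_nat_recl // expr0 fact0 divr1 big1 ?addr0 // => k _.
by rewrite exprS !mul0r.
Qed.

(** By the product rule [cexp (c x) cexp (e x) cexp (- (c + e) x)] has derivative
    zero in the real variable [x], and it is [1] at [x = 0]. *)
Lemma cexpDK (c e : C) : cexp c * cexp e * cexp (- (c + e)) = 1.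
Proof.
pose E (c : C) (x : R) : 'M[C]_1 := (cexp (c * x%:C))%:M.
pose F (x : R) := E c x *m E e x *m E (- (c + e)) x.
have product_rule (K : fieldType) (u v a b d : K) :
    0 = ((u * a)%:M *m b%:M + a%:M *m (v * b)%:M) *m d%:M
      + (a%:M *m b%:M) *m ((- (u + v)) * d)%:M :> 'M[K]_1.
  by apply/matrixP => i j; rewrite mulmxDl -!scalar_mxM !mxE !ord1 eqxx; ring.
have F01 : F 0 = F 1.
  apply: (@deriv0_eq R setT) => // y _.
  rewrite (product_rule _ c e (cexp (c * y%:C)) (cexp (e * y%:C))
    (cexp (- (c + e) * y%:C))).
  exact: derivM (derivM (@cexp_deriv setT c y) (@cexp_deriv setT e y))
    (@cexp_deriv setT (- (c + e)) y).
pose G (x : R) := cexp (c * x%:C) * cexp (e * x%:C) * cexp (- (c + e) * x%:C).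
have scalarI (K : fieldType) (a b d a' b' d' : K) :
    a%:M *m b%:M *m d%:M = a'%:M *m b'%:M *m d'%:M :> 'M[K]_1 ->
    a * b * d = a' * b' * d'.
  by rewrite -!scalar_mxM => /matrixP/(_ 0 0); rewrite !mxE.
have G01 : G 0 = G 1 := scalarI _ _ _ _ _ _ _ F01.
move: G01; rewrite /G rmorph0 rmorph1 !mulr0 !mulr1 cexp0 !mulr1.
by move=> <-.
Qed.

Lemma cexpNK (c : C) : cexp c * cexp (- c) = 1.
Proof. by have := cexpDK c 0; rewrite cexp0 mulr1 addr0. Qed.

Lemma cexp_neq0 (c : C) : cexp c != 0.
Proof.
by apply/eqP => c0; have /eqP := cexpNK c; rewrite c0 mul0r eq_sym oner_eq0.
Qed.

Lemma cexpD (c e : C) : cexp (c + e) = cexp c * cexp e.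
Proof.
apply: (mulIf (cexp_neq0 (- (c + e)))).
by rewrite cexpNK cexpDK.
Qed.

Lemma expr_diag_mx m (v : 'rV[C]_m) k :
  diag_mx v ^+ k = diag_mx (\row_j v 0 j ^+ k).
Proof.
elim: k => [|k IH].
  rewrite expr0 -[RHS]/(diag_mx _); apply/matrixP => i j.
  by rewrite !mxE expr0.
rewrite exprS IH; apply/matrixP => i j.
rewrite -[_ * _]/(_ *m _) mul_diag_mx !mxE exprS.
by case: eqP => [->|] //; rewrite ?mulr1n // mulr0n mulr0.
Qed.

Lemma mxexp_diag m (v : 'rV[C]_m) :
  mxexp (diag_mx v) = diag_mx (\row_j cexp (v 0 j)).
Proof.
apply/matrixP => i j; rewrite [LHS]mxE.
have -> : (fun k => (diag_mx v ^+ k) i j / (k`!)%:R : C^o) =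
    (fun k => (v 0 i ^+ k / (k`!)%:R) *+ (i == j) : C^o).
  by apply/funext => k; rewrite expr_diag_mx !mxE -mulrnAl.
rewrite !mxE; case: (i == j) => //.
rewrite !mulr0n; apply: clim_limn.
have h0 : clim \oo (fun=> 0 : C) 0 by exact: clim_cst.
apply: clim_near h0; apply: nearW => n.
by rewrite /series /= big1.
Qed.

End Exponential.

(** * Nilpotent matrices and the Darboux matrix *)

Section Nilpotent.

(** The characteristic polynomial splits, and all its roots are zero; so it is
    ['X^n], and the Cayley-Hamilton theorem applies. *)
Lemma nilpotent_eigenvalue (K : closedFieldType) n (A : 'M[K]_n) :
  (forall a, eigenvalue A a -> a = 0) -> A ^+ n = 0.
Proof.
case: n A => [A _|n A hA]; first by rewrite [LHS]flatmx0 [RHS]flatmx0.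
have [r rE] := closed_field_poly_normal (char_poly A).
rewrite (monicP (char_poly_monic A)) scale1r in rE.
have r0 a : a \in r -> a = 0.
  by move=> ar; apply: hA; rewrite eigenvalue_root_char rE root_prod_XsubC.
have chE : char_poly A = 'X^(size r).
  rewrite rE big_seq (eq_bigr (fun=> 'X)) => [|a /r0 ->]; last first.
    by rewrite polyC0 subr0.
  by rewrite -big_seq big_const_seq count_predT iter_mulr_1.
have sr : size r = n.+1.
  by apply: succn_inj; rewrite -(size_char_poly A) chE size_polyXn.
have := Cayley_Hamilton A.
by rewrite chE sr rmorphXn /= horner_mx_X.
Qed.

Variables (K : fieldType) (n : nat) (A : 'M[K]_n).
Hypothesis An0 : A ^+ n = 0.

(** The Neumann series of the resolvent of a nilpotent matrix is finite, and the
    product telescopes. *)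
Lemma nilpotent_resolvent_mul (z : K) : z != 0 ->
  (A - z%:M) *m (- \sum_(k < n) z^-1 ^+ k.+1 *: A ^+ k) = 1%:M.
Proof.
move=> z0; rewrite mulmxN mulmx_sumr.
pose f k := z^-1 ^+ k *: A ^+ k.
rewrite (eq_bigr (fun k : 'I_n => f k.+1 - f k)) => [|k _]; last first.
  rewrite mulmxBl -scalemxAr -scalemxAr mul_scalar_mx scalerA; congr (_ - _).
    by rewrite /f; congr (_ *: _); rewrite exprS.
  by rewrite /f exprSr -mulrA mulVf // mulr1.
rewrite -(big_mkord xpredT (fun k => f k.+1 - f k)) telescope_sumr //.
by rewrite /f An0 scaler0 sub0r opprK !expr0 scale1r.
Qed.

Lemma nilpotent_sub_unit (z : K) : z != 0 -> A - z%:M \in unitmx.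
Proof. by move=> /nilpotent_resolvent_mul /mulmx1_unit []. Qed.

Lemma nilpotent_resolvent (z : K) : z != 0 ->
  invmx (A - z%:M) = - \sum_(k < n) z^-1 ^+ k.+1 *: A ^+ k.
Proof.
move=> z0; rewrite -[RHS](mulKmx (nilpotent_sub_unit z0)).
by rewrite nilpotent_resolvent_mul // mulmx1.
Qed.

End Nilpotent.

(** The facts below are purely algebraic.  The matrix [Ps] stands for the adjoint
    of [Pi], the matrix [A'] for the adjoint of [A], and [j] for the imaginary
    unit. *)
Section DarbouxAlgebra.
Variables (K : fieldType) (m n : nat) (j : K).
Hypothesis jj : j * j = -1.
Variables (A A' S : 'M[K]_n) (B D : 'M[K]_m).
Variables (Pi : 'M[K]_(n, m)) (Ps : 'M[K]_(m, n)).
Hypothesis uS : S \in unitmx.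
Hypothesis identity : A *m S - S *m A' = j *: (Pi *m B *m Ps).

Let X := B *m Ps *m invmx S.
Let rho := - (X *m Pi).

Lemma mxscale_jj p q (M : 'M[K]_(p, q)) : j *: (j *: M) = - M.
Proof. by rewrite scalerA jj scaleN1r. Qed.

Lemma identity_mid : Pi *m B *m Ps = - (j *: (A *m S - S *m A')).
Proof. by rewrite identity mxscale_jj opprK. Qed.

(** The cross term contains [Pi B Ps], which by the identity equals
    [- j ((A - z) S - S (A' - z))]; so it splits into two terms with a single
    resolvent each, and these cancel the linear ones. *)
Lemma darboux_mul_inverse (z : K) :
  A - z%:M \in unitmx -> A' - z%:M \in unitmx ->
  (1%:M - j *: (X *m invmx (A - z%:M) *m Pi)) *m
  (1%:M + j *: (B *m Ps *m invmx (A' - z%:M) *m invmx S *m Pi)) = 1%:M.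
Proof.
move=> uG uG'; set G := invmx (A - z%:M); set G' := invmx (A' - z%:M).
have cross : X *m G *m Pi *m (B *m Ps *m G' *m invmx S *m Pi) =
    - (j *: (B *m Ps *m G' *m invmx S *m Pi - X *m G *m Pi)).
  have -> : X *m G *m Pi *m (B *m Ps *m G' *m invmx S *m Pi) =
      X *m G *m (Pi *m B *m Ps) *m (G' *m invmx S *m Pi) by rewrite !mulmxA.
  have -> : Pi *m B *m Ps =
      - (j *: ((A - z%:M) *m S - S *m (A' - z%:M))).
    rewrite identity_mid mulmxBl mulmxBr mul_scalar_mx mul_mx_scalar.
    by rewrite opprB addrA subrK.
  rewrite mulmxN mulNmx -scalemxAr -scalemxAl mulmxBr mulmxBl.
  congr (- (_ *: (_ - _))).
    rewrite !mulmxA -[X *m G *m _]mulmxA mulVmx // mulmx1.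
    by rewrite /X -[_ *m invmx S *m S]mulmxA mulVmx // mulmx1.
  rewrite !mulmxA -[_ *m (A' - z%:M) *m G']mulmxA mulmxV // mulmx1.
  by rewrite -[_ *m S *m invmx S]mulmxA mulmxV // mulmx1.
rewrite mulmxDr mulmx1 mulmxBl mul1mx -scalemxAl -scalemxAr cross.
rewrite mxscale_jj opprK scalerBr; set u := j *: _; set v := j *: _.
by rewrite opprB (addrC v) subrK subrK.
Qed.

(** The resolvent identity [A (A - z)^-1 = 1 + z (A - z)^-1] turns the
    derivative of the Darboux matrix into the commutators with [D]. *)
Lemma darboux_deriv_algebra (z : K) : A - z%:M \in unitmx ->
  - (j *: ((j *: (D *m X *m A) - (D *m rho - rho *m D) *m X)
       *m invmx (A - z%:M) *m Pi
     + X *m invmx (A - z%:M) *m (- (j *: (A *m Pi *m D))))) =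
  ((j * z) *: D - (D *m rho - rho *m D)) *m
     (1%:M - j *: (X *m invmx (A - z%:M) *m Pi)) -
  (1%:M - j *: (X *m invmx (A - z%:M) *m Pi)) *m ((j * z) *: D).
Proof.
move=> uG; set G := invmx (A - z%:M); set N := _ - rho *m D.
have AG : A *m G = 1%:M + z *: G.
  rewrite -{1}(subrK z%:M A) mulmxDl mulmxV // mul_scalar_mx //.
have GA : G *m A = 1%:M + z *: G.
  rewrite -{1}(subrK z%:M A) mulmxDr mulVmx // mul_mx_scalar //.
have e1 : D *m X *m A *m G *m Pi = D *m X *m Pi + z *: (D *m (X *m G *m Pi)).
  rewrite -[_ *m A *m G]mulmxA AG mulmxDr mulmx1 -scalemxAr mulmxDl -scalemxAl.
  by rewrite !mulmxA.
have e2 : X *m G *m (A *m Pi *m D) = X *m Pi *m D + z *: (X *m G *m Pi *m D).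
  rewrite !mulmxA -[X *m G *m A]mulmxA GA mulmxDr mulmx1 -scalemxAr !mulmxDl.
  by rewrite -!scalemxAl.
have e3 : D *m X *m Pi - X *m Pi *m D = - N.
  by rewrite /N /rho mulmxN mulNmx (mulmxA D X) opprK opprD opprK.
clearbody N; set Y := X *m G *m Pi in e1 e2 *.
have -> : (j *: (D *m X *m A) - N *m X) *m G *m Pi =
    j *: (D *m X *m Pi + z *: (D *m Y)) - N *m Y.
  rewrite mulmxBl mulmxBl -scalemxAl -scalemxAl e1.
  by rewrite -(mulmxA N X) -(mulmxA N (X *m G)).
have -> : X *m G *m (- (j *: (A *m Pi *m D))) =
    - (j *: (X *m Pi *m D + z *: (Y *m D))).
  by rewrite mulmxN -scalemxAr e2.
have -> : ((j * z) *: D - N) *m (1%:M - j *: Y) =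
    (j * z) *: D - N - (j * z * j) *: (D *m Y) + j *: (N *m Y).
  rewrite mulmxBr mulmx1 -scalemxAr mulmxBl -scalemxAl.
  move: (D *m Y) (N *m Y) => U T.
  by apply/matrixP => k l; rewrite !mxE; ring.
have -> : (1%:M - j *: Y) *m ((j * z) *: D) =
    (j * z) *: D - (j * z * j) *: (Y *m D).
  rewrite mulmxBl mul1mx -scalemxAl -scalemxAr; move: (Y *m D) => V.
  by apply/matrixP => k l; rewrite !mxE; ring.
have <- : - (D *m X *m Pi - X *m Pi *m D) = N by rewrite e3 opprK.
move: (D *m X *m Pi) (X *m Pi *m D) (D *m Y) (Y *m D) (N *m Y) => P Q U V T.
by apply/matrixP => k l; rewrite !mxE; ring: jj.
Qed.

(** The left-hand side is the derivative of [X] by the product rule; the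
    identity trades [A' S^-1] for [S^-1 A]. *)
Lemma darboux_left_deriv_algebra : D *m B = B *m D ->
  (0 *m Ps + B *m (j *: (D *m Ps *m A'))) *m invmx S +
    B *m Ps *m - (invmx S *m (Pi *m D *m B *m Ps) *m invmx S) =
  j *: (D *m X *m A) - (D *m rho - rho *m D) *m X.
Proof.
move=> DB.
have A'S : A' *m invmx S = invmx S *m A - j *: (invmx S *m Pi *m X).
  have -> : A' *m invmx S = invmx S *m (S *m A') *m invmx S.
    by rewrite (mulmxA _ S) mulVmx // mul1mx.
  have -> : S *m A' = A *m S - j *: (Pi *m B *m Ps).
    by rewrite -identity opprB addrC subrK.
  rewrite mulmxBr mulmxBl -scalemxAr -scalemxAl /X !mulmxA.
  by rewrite -[_ *m S *m invmx S]mulmxA mulmxV // mulmx1.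
rewrite mul0mx add0r -scalemxAr -scalemxAl.
have -> : B *m (D *m Ps *m A') *m invmx S = D *m X *m A - j *: (D *m X *m Pi *m X).
  rewrite -(mulmxA B) -(mulmxA (D *m Ps)) A'S !mulmxA -DB mulmxBr -scalemxAr.
  by rewrite /X !mulmxA.
have -> : B *m Ps *m - (invmx S *m (Pi *m D *m B *m Ps) *m invmx S) =
    - (X *m Pi *m D *m X) by rewrite mulmxN /X !mulmxA.
have -> : (D *m rho - rho *m D) *m X =
    - (D *m X *m Pi *m X) + X *m Pi *m D *m X.
  by rewrite mulmxBl /rho mulmxN !mulNmx opprK (mulmxA D X).
move: (D *m X *m A) (D *m X *m Pi *m X) (X *m Pi *m D *m X) => P Q U.
by apply/matrixP => k l; rewrite !mxE; ring: jj.
Qed.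

(** The left-hand side is the derivative of [A S - S A' - j Pi B Ps] along the
    system for [Pi] and [S], so the identity is conserved. *)
Lemma identity_deriv_algebra : D *m B = B *m D ->
  A *m (Pi *m D *m B *m Ps) - Pi *m D *m B *m Ps *m A' -
    j *: ((- (j *: (A *m Pi *m D))) *m B *m Ps
       + Pi *m B *m (j *: (D *m Ps *m A'))) = 0.
Proof.
move=> DB.
have -> : (- (j *: (A *m Pi *m D))) *m B *m Ps =
    - (j *: (A *m (Pi *m D *m B *m Ps))).
  by rewrite !mulNmx -!scalemxAl !mulmxA.
have -> : Pi *m B *m (j *: (D *m Ps *m A')) =
    j *: (Pi *m D *m B *m Ps *m A').
  by rewrite -scalemxAr !mulmxA -(mulmxA Pi B) -DB !mulmxA.
move: (A *m _) (_ *m A') => P Q.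
by apply/matrixP => k l; rewrite !mxE; ring: jj.
Qed.

End DarbouxAlgebra.

Lemma adj_skew (K : numClosedFieldType) (j : K) m n (A : 'M[K]_n)
    (D : 'M[K]_m) (Pi : 'M[K]_(n, m)) :
  (j^*)%R = - j -> (D^t*)%sesqui = D ->
  ((- (j *: (A *m Pi *m D)))^t*)%sesqui =
    j *: (D *m (Pi^t*)%sesqui *m (A^t*)%sesqui).
Proof.
move=> jc Dc; rewrite -{2}Dc linearN /= linearZ /= !trmx_mul.
by rewrite map_mxN map_mxZ !map_mxM /= jc scaleNr opprK mulmxA.
Qed.

Lemma adj_sub_scalar_unit (K : numClosedFieldType) n (A : 'M[K]_n) (z : K) :
  A - (z^*)%R%:M \in unitmx -> (A^t*)%sesqui - z%:M \in unitmx.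
Proof.
move=> uA; have -> : (A^t*)%sesqui - z%:M = ((A - (z^*)%R%:M)^t*)%sesqui.
  by rewrite linearB /= tr_scalar_mx map_mxB map_scalar_mx /= conjCK.
by rewrite map_unitmx unitmx_tr.
Qed.

(** * The derivative of the Darboux matrix *)

Section FundamentalSolution.
Variable R : realType.
Local Notation C := R[i].

Lemma conj_imag : (('i%C : C)^*)%R = - 'i%C.
Proof. by rewrite complexiE conjCi. Qed.

Lemma imag_imag : ('i%C : C) * 'i%C = -1.
Proof. by rewrite complexiE -expr2 sqrCi. Qed.

Lemma rdiag_adj m (d : 'rV[R]_m) : ((rdiag d)^t*)%sesqui = rdiag d.
Proof.
rewrite /rdiag tr_diag_mx map_diag_mx; congr diag_mx.
by apply/matrixP => i k; rewrite !mxE; exact: conjc_real.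
Qed.

Lemma rdiagC m (d e : 'rV[R]_m) : rdiag d *m rdiag e = rdiag e *m rdiag d.
Proof. exact: diag_mxC. Qed.

Section DarbouxDerivative.
Variables (m n : nat) (A : 'M[C]_n) (d b : 'rV[R]_m).
Let D := rdiag d.
Let B := rdiag b.
Variables (I : set R) (Pi : R -> 'M[C]_(n, m)) (S : R -> 'M[C]_n).
Hypothesis hPi : forall x, I x ->
  deriv_within I Pi x (- ('i%C *: (A *m Pi x *m D))).
Hypothesis hS : forall x, I x ->
  deriv_within I S x (Pi x *m D *m B *m ((Pi x)^t*)%sesqui).

(** The operator identity of an S-node. *)
Definition node_identity (P : 'M[C]_(n, m)) (T : 'M[C]_n) : Prop :=
  A *m T - T *m (A^t*)%sesqui = 'i%C *: (P *m B *m (P^t*)%sesqui).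

Lemma adj_deriv x : I x ->
  deriv_within I (fun y => ((Pi y)^t*)%sesqui) x
    ('i%C *: (D *m ((Pi x)^t*)%sesqui *m (A^t*)%sesqui)).
Proof.
move=> Ix; rewrite -(adj_skew A (Pi x) conj_imag (rdiag_adj d)).
exact: deriv_adj (hPi Ix).
Qed.

Lemma mulmx_cst_deriv p q r (M : 'M[C]_(p, q)) (F : R -> 'M[C]_(q, r)) x L :
  deriv_within I F x L -> deriv_within I (fun y => M *m F y) x (M *m L).
Proof.
by move=> h; have := derivM (deriv_cst I M x) h; rewrite mul0mx add0r.
Qed.

Lemma mulmx_deriv_cst p q r (F : R -> 'M[C]_(p, q)) (M : 'M[C]_(q, r)) x L :
  deriv_within I F x L -> deriv_within I (fun y => F y *m M) x (L *m M).
Proof.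
by move=> h; have := derivM h (deriv_cst I M x); rewrite mulmx0 addr0.
Qed.

Lemma node_identity_propagates x y : x <= y ->
  (forall s, x <= s <= y -> I s) ->
  node_identity (Pi x) (S x) -> node_identity (Pi y) (S y).
Proof.
move=> xy sI hx; apply/eqP; rewrite -subr_eq0; apply/eqP.
pose F s := A *m S s - S s *m (A^t*)%sesqui
  - 'i%C *: (Pi s *m B *m ((Pi s)^t*)%sesqui).
have Fxy : F x = F y.
  apply: (deriv0_eq xy sI) => s /sI Is.
  rewrite -(identity_deriv_algebra imag_imag A (A^t*)%sesqui (Pi s)
    ((Pi s)^t*)%sesqui (rdiagC d b)).
  apply: derivD; last first.
    apply: derivN; apply: derivZ; apply: derivM; last exact: adj_deriv.
    exact: mulmx_deriv_cst (hPi Is).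
  apply: derivD; first exact: mulmx_cst_deriv (hS Is).
  by apply: derivN; exact: mulmx_deriv_cst (hS Is).
rewrite -/(F y) -Fxy /F; apply/eqP; rewrite subr_eq0; exact/eqP.
Qed.

Hypothesis uS : forall x, I x -> S x \in unitmx.
Hypothesis identity : forall x, I x -> node_identity (Pi x) (S x).

(** This is the equation of the dressed solution with the exponential removed:
    multiplying [darboux] by a solution [E] of [E' = i z D E] cancels the last
    term. *)
Lemma darboux_deriv z x : I x -> A - z%:M \in unitmx ->
  deriv_within I (fun y => darboux A B (Pi y) (S y) z) x
    (('i%C * z *: D - commutator D (rho_tilde B (Pi x) (S x)))
       *m darboux A B (Pi x) (S x) z
     - darboux A B (Pi x) (S x) z *m ('i%C * z *: D)).
Proof.
move=> Ix uG.
have hX : deriv_within I (fun y => B *m ((Pi y)^t*)%sesqui *m invmx (S y)) x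
    ('i%C *: (D *m (B *m ((Pi x)^t*)%sesqui *m invmx (S x)) *m A) -
     commutator D (rho_tilde B (Pi x) (S x))
       *m (B *m ((Pi x)^t*)%sesqui *m invmx (S x))).
  rewrite -(darboux_left_deriv_algebra imag_imag (uS Ix) (identity Ix)
    (rdiagC d b)).
  apply: derivM; last exact: deriv_inv Ix uS (hS Ix).
  by apply: derivM; [exact: deriv_cst | exact: adj_deriv].
rewrite -(darboux_deriv_algebra imag_imag (S x) B D (Pi x)
  ((Pi x)^t*)%sesqui uG).
rewrite -[- (_ *: _)]add0r; apply: derivD; first exact: deriv_cst.
apply: derivN; apply: derivZ; apply: derivM; last exact: hPi.
exact: mulmx_deriv_cst hX.
Qed.

End DarbouxDerivative.

Lemma darboux_unit m n (A : 'M[C]_n) (b : 'rV[R]_m) P (T : 'M[C]_n) z :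
  node_identity A b P T -> T \in unitmx ->
  A - z%:M \in unitmx -> A - (z^*)%R%:M \in unitmx ->
  darboux A (rdiag b) P T z \in unitmx.
Proof.
move=> idT uT uz /adj_sub_scalar_unit uz'.
by have /mulmx1_unit[] := darboux_mul_inverse imag_imag uT idT uz uz'.
Qed.

End FundamentalSolution.

(** * Linear systems with a gauge factor *)

(* From here on only the derivative and the functional equation of [cexp] are
   used, not the series. *)
Opaque cexp.

Section LinearSystems.

Lemma undress_algebra (K : fieldType) m (E E' w W U : 'M[K]_m) :
  w \in unitmx -> E *m E' = 1%:M -> E' *m invmx w *m W = U ->
  W = w *m E *m U.
Proof.
move=> uw EE' <-; rewrite !mulmxA -[w *m E *m E']mulmxA EE' mulmx1.
by rewrite mulmxV // mul1mx.
Qed.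

(** The left-hand side is the derivative of [E w^-1 W], where [E' = - H E],
    [w' = M w - w H] and [W' = M W]. *)
Lemma transport_algebra (K : fieldType) m (E H M w W : 'M[K]_m) :
  w \in unitmx -> H *m E = E *m H ->
  ((- H) *m E *m invmx w + E *m - (invmx w *m (M *m w - w *m H) *m invmx w))
    *m W + E *m invmx w *m (M *m W) = 0.
Proof.
move=> uw HE.
have -> : invmx w *m (M *m w - w *m H) *m invmx w = invmx w *m M - H *m invmx w.
  rewrite mulmxBr mulmxBl !mulmxA mulVmx // mul1mx.
  by rewrite -[_ *m w *m invmx w]mulmxA mulmxV // mulmx1.
rewrite mulmxN mulmxBr !mulNmx HE !mulmxA opprB addrA addNr add0r mulNmx.
exact: addNr.
Qed.

(** The left-hand side is the derivative of [w E c], where [E' = H E] and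
    [w' = M w - w H]. *)
Lemma dressed_algebra (K : fieldType) m (E H M w c : 'M[K]_m) :
  ((M *m w - w *m H) *m E + w *m (H *m E)) *m c = M *m (w *m E *m c).
Proof. by rewrite mulmxBl !mulmxA subrK. Qed.

Variable R : realType.
Local Notation C := R[i].
Variables (m : nat) (I : set R).
Implicit Type v : 'rV[C]_m.

Definition expz v (x : R) : 'M[C]_m := diag_mx (\row_k cexp (v 0 k * x%:C)).

Lemma expz_deriv v x :
  deriv_within I (expz v) x (diag_mx v *m expz v x).
Proof.
rewrite mul_diag_mx; apply/deriv_slopeP => i j.
have /deriv_slopeP/(_ 0 0) := @cexp_deriv R I (v 0 i) x.
rewrite !mxE eqxx mulr1n => h.
case: (eqVneq i j) => [<-|ij].
  rewrite mulr1n; apply: clim_near h; apply: nearW => y.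
  by rewrite /slope !mxE !eqxx !mulr1n.
have h0 : clim (within I x^') (fun=> 0 : C) 0 by exact: clim_cst.
rewrite mulr0n mulr0; apply: clim_near h0; apply: nearW => y.
by rewrite /slope !mxE (negbTE ij) !mulr0n subrr mulr0.
Qed.

Arguments expz_deriv : clear implicits.

Lemma expz0 v : expz v 0 = 1%:M.
Proof.
rewrite -diag_const_mx; congr diag_mx; apply/rowP => k.
by rewrite !mxE rmorph0 mulr0 cexp0.
Qed.

Lemma expzNK v x : expz v x *m expz (- v) x = 1%:M.
Proof.
rewrite mul_diag_mx -diag_const_mx; apply/matrixP => i j; rewrite !mxE.
case: (i == j); last by rewrite mulr0n mulr0.
by rewrite !mulr1n mulNr cexpNK.
Qed.

Lemma expzC v v' x x' : expz v x *m expz v' x' = expz v' x' *m expz v x.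
Proof. exact: diag_mxC. Qed.

Section Transport.
Variables (v : 'rV[C]_m) (M w : R -> 'M[C]_m).
Hypothesis hw : forall x, I x ->
  deriv_within I w x (M x *m w x - w x *m diag_mx v).

Lemma dressed_deriv (c : 'M[C]_m) x : I x ->
  deriv_within I (fun y => w y *m expz v y *m c) x
    (M x *m (w x *m expz v x *m c)).
Proof.
move=> Ix; rewrite -(dressed_algebra _ (diag_mx v)).
by apply: mulmx_deriv_cst; apply: derivM (hw Ix) (expz_deriv v x).
Qed.

Hypothesis uw : forall x, I x -> w x \in unitmx.

(** Undressing a solution [W] by [w] leaves the constant-coefficient system
    with matrix [diag_mx v]; undressing by its exponential too leaves a
    constant. *)
Lemma undressed_const (W : R -> 'M[C]_m) x y : x <= y ->
  (forall s, x <= s <= y -> I s) ->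
  (forall s, I s -> deriv_within I W s (M s *m W s)) ->
  expz (- v) x *m invmx (w x) *m W x = expz (- v) y *m invmx (w y) *m W y.
Proof.
move=> xy sI hW.
apply: (@deriv0_eq R I m m (fun s => expz (- v) s *m invmx (w s) *m W s)
  x y xy sI) => s /sI Is.
have HE : diag_mx v *m expz (- v) s = expz (- v) s *m diag_mx v.
  exact: diag_mxC.
rewrite -(transport_algebra (M s) (W s) (uw Is) HE) -linearN.
apply: derivM (hW _ Is); apply: derivM; first exact: expz_deriv.
exact: deriv_inv Is uw (hw Is).
Qed.

Lemma solution_dressed (W : R -> 'M[C]_m) x : 0 <= x ->
  (forall s, 0 <= s <= x -> I s) ->
  (forall s, I s -> deriv_within I W s (M s *m W s)) ->
  W x = w x *m expz v x *m invmx (w 0) *m W 0.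
Proof.
move=> x0 sI hW; have Ix : I x by apply: sI; rewrite x0 lexx.
have := undressed_const x0 sI hW; rewrite expz0 mul1mx => e.
rewrite -(mulmxA _ (invmx (w 0))).
exact: undress_algebra (uw Ix) (expzNK v x) (esym e).
Qed.

End Transport.

Lemma diag_spectral (d : 'rV[R]_m) (a : C) :
  diag_mx (a *: map_mx (real_complex R) d) = a *: rdiag d.
Proof. by rewrite /rdiag linearZ. Qed.

Lemma mxexp_rdiag (d : 'rV[R]_m) (a : C) (x : R) :
  mxexp (a * x%:C *: rdiag d) = expz (a *: map_mx (real_complex R) d) x.
Proof.
rewrite -diag_spectral mxexp_diag /expz; congr diag_mx.
by apply/rowP => k; rewrite !mxE mulrAC.
Qed.

Lemma mxexp_rdiag2 (d e : 'rV[R]_m) (a : C) (x t : R) :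
  mxexp (a *: (x%:C *: rdiag d + t%:C *: rdiag e)) =
  expz (a *: map_mx (real_complex R) d) x *m
  expz (a *: map_mx (real_complex R) e) t.
Proof.
rewrite scalerDr !scalerA -!diag_spectral -linearD mxexp_diag mulmx_diag.
congr diag_mx; apply/rowP => k; rewrite !mxE cexpD.
by rewrite (mulrAC a x%:C) (mulrAC a t%:C).
Qed.

End LinearSystems.

(** * Matrix families given by polynomials *)

Section PolynomialFamilies.
Variables (K : comNzRingType) (L : fieldType) (T : Type).
Variables (dom : T -> Prop) (ev : T -> {rmorphism K -> L}).

(** For [K] a polynomial ring and [ev] its evaluations at the points of [T], this
    says that [F] is a matrix polynomial.  Since evaluation is a ring morphism,
    determinants and adjugates are covered by functoriality. *)
Definition polymx p q (F : T -> 'M[L]_(p, q)) : Prop :=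
  exists P : 'M[K]_(p, q), forall t, dom t -> F t = map_mx (ev t) P.

Lemma polymxD p q (F G : T -> 'M[L]_(p, q)) :
  polymx F -> polymx G -> polymx (fun t => F t + G t).
Proof.
move=> [P hP] [Q hQ]; exists (P + Q) => t dt.
by rewrite map_mxD (hP _ dt) (hQ _ dt).
Qed.

Lemma polymxN p q (F : T -> 'M[L]_(p, q)) :
  polymx F -> polymx (fun t => - F t).
Proof. by move=> [P hP]; exists (- P) => t dt; rewrite map_mxN (hP _ dt). Qed.

Lemma polymxM p q r (F : T -> 'M[L]_(p, q)) (G : T -> 'M[L]_(q, r)) :
  polymx F -> polymx G -> polymx (fun t => F t *m G t).
Proof.
move=> [P hP] [Q hQ]; exists (P *m Q) => t dt.
by rewrite map_mxM (hP _ dt) (hQ _ dt).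
Qed.

Lemma polymx_adj n (F : T -> 'M[L]_n) :
  polymx F -> polymx (fun t => \adj (F t)).
Proof.
by move=> [P hP]; exists (\adj P) => t dt; rewrite map_mx_adj (hP _ dt).
Qed.

Lemma polymx_det n (F : T -> 'M[L]_n) : polymx F ->
  exists q : K, forall t, dom t -> \det (F t) = ev t q.
Proof.
by move=> [P hP]; exists (\det P) => t dt; rewrite (hP _ dt) det_map_mx.
Qed.

Lemma polymxZ p q (c : T -> L) (F : T -> 'M[L]_(p, q)) :
  (exists k, forall t, dom t -> c t = ev t k) ->
  polymx F -> polymx (fun t => c t *: F t).
Proof.
move=> [k hk] [P hP]; exists (k *: P) => t dt.
by rewrite map_mxZ /= (hP _ dt) (hk _ dt).
Qed.

Lemma polymx_sum p q (I : Type) (r : seq I) (F : I -> T -> 'M[L]_(p, q)) :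
  (forall i, polymx (F i)) -> polymx (fun t => \sum_(i <- r) F i t).
Proof.
move=> hF; elim: r => [|i r IH].
  by exists 0 => t _; rewrite big_nil map_mx0.
have [P hP] := polymxD (hF i) IH.
by exists P => t dt; rewrite big_cons hP.
Qed.

Lemma polymx_eq p q (F G : T -> 'M[L]_(p, q)) :
  (forall t, dom t -> F t = G t) -> polymx F -> polymx G.
Proof. by move=> e [P hP]; exists P => t dt; rewrite -e // hP. Qed.

Variable iota : L -> K.
Hypothesis iotaK : forall t c, ev t (iota c) = c.

Lemma polymx_cst p q (M : 'M[L]_(p, q)) : polymx (fun=> M).
Proof.
exists (map_mx iota M) => t _; apply/matrixP => i j.
by rewrite !mxE iotaK.
Qed.

Lemma polymxZ_cst p q (c : L) (F : T -> 'M[L]_(p, q)) :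
  polymx F -> polymx (fun t => c *: F t).
Proof. by apply: polymxZ; exists (iota c) => t _; rewrite iotaK. Qed.

Variables (m n : nat) (B : 'M[L]_m).
Variables (Pi : T -> 'M[L]_(n, m)) (Ps : T -> 'M[L]_(m, n)) (S : T -> 'M[L]_n).
Hypotheses (hPi : polymx Pi) (hPs : polymx Ps) (hS : polymx S).

Lemma cramer p q (t : T) (M : 'M[L]_(p, n)) (N : 'M[L]_(n, q)) :
  S t \in unitmx ->
  M *m invmx (S t) *m N = (\det (S t))^-1 *: (M *m \adj (S t) *m N).
Proof. by move=> uS; rewrite /invmx uS -scalemxAr -scalemxAl. Qed.

Lemma rho_polymx : exists p : 'M[K]_m, forall t, dom t -> S t \in unitmx ->
  - (B *m Ps t *m invmx (S t) *m Pi t) = (\det (S t))^-1 *: map_mx (ev t) p.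
Proof.
have [P hP] := polymxN (polymxM (polymxM (polymxM (polymx_cst B) hPs)
  (polymx_adj hS)) hPi).
by exists P => t dt uS; rewrite -hP // cramer // scalerN.
Qed.

(** By Cramer's rule only the resolvent needs an argument.  Here [zeta] stands
    for the variable [1 / z], in which the resolvent of a nilpotent matrix is
    polynomial. *)
Lemma darboux_polymx (A : 'M[L]_n) (j : L) (z : T -> L) (zeta : K) :
  A ^+ n = 0 ->
  (forall t, dom t -> z t != 0) -> (forall t, dom t -> (z t)^-1 = ev t zeta) ->
  exists P : 'M[K]_m, forall t, dom t -> S t \in unitmx ->
    1%:M - j *: (B *m Ps t *m invmx (S t) *m invmx (A - (z t)%:M) *m Pi t) =
    (\det (S t))^-1 *: map_mx (ev t) P.
Proof.
move=> An0 z0 zE.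
have hG : polymx (fun t => invmx (A - (z t)%:M)).
  apply: (@polymx_eq _ _ (fun t =>
    - \sum_(k < n) (z t)^-1 ^+ k.+1 *: A ^+ k)).
    by move=> t /z0 zt; rewrite nilpotent_resolvent.
  apply: polymxN; apply: polymx_sum => k; apply: polymxZ; last exact: polymx_cst.
  by exists (zeta ^+ k.+1) => t dt; rewrite rmorphXn /= -zE.
have [P hP] : polymx (fun t => \det (S t) *: 1%:M -
    j *: (B *m Ps t *m \adj (S t) *m invmx (A - (z t)%:M) *m Pi t)).
  apply: polymxD; first by apply: polymxZ (polymx_det hS) (polymx_cst _).
  apply: polymxN; apply: polymxZ_cst; apply: polymxM hPi; apply: polymxM hG.
  by apply: polymxM (polymx_adj hS); apply: polymxM hPs; apply: polymx_cst.
exists P => t dt uS; rewrite -hP // scalerBr scalerA mulVf; last first.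
  by rewrite -unitfE -unitmxE.
rewrite scale1r; congr (_ - _).
rewrite [RHS]scalerA mulrC -scalerA; congr (_ *: _).
by rewrite cramer // -!scalemxAl.
Qed.

End PolynomialFamilies.

(** * Evaluation of polynomials in one, two and three variables *)

Section Evaluation.
Variable L : fieldType.

Definition ev1 (a : L) : {rmorphism {poly L} -> L} := horner_eval a.

Definition ev2 (a b : L) : {rmorphism {poly {poly L}} -> L} :=
  horner_eval b \o horner_eval a%:P.

Definition ev3 (a b c : L) : {rmorphism {poly {poly {poly L}}} -> L} :=
  horner_eval c \o (horner_eval b%:P \o horner_eval a%:P%:P).

Lemma ev1C a c : ev1 a c%:P = c.
Proof. exact: hornerC. Qed.

Lemma ev2C a b c : ev2 a b c%:P%:P = c.
Proof. by rewrite /ev2 /= /horner_eval !hornerC. Qed.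

Lemma ev3C a b c e : ev3 a b c e%:P%:P%:P = e.
Proof. by rewrite /ev3 /= /horner_eval !hornerC. Qed.

Lemma ev2_outer a b p : ev2 a b (map_poly polyC p) = ev1 a p.
Proof. by rewrite /ev2 /ev1 /= /horner_eval horner_map hornerC. Qed.

Lemma ev2_inner a b p : ev2 a b p%:P = ev1 b p.
Proof. by rewrite /ev2 /ev1 /= /horner_eval hornerC. Qed.

Lemma ev3_outer a b c p : ev3 a b c (map_poly (map_poly polyC) p) = ev2 a b p.
Proof.
rewrite /ev3 /ev2 /= /horner_eval.
have -> : a%:P%:P = map_poly polyC a%:P :> {poly {poly L}} by rewrite map_polyC.
by rewrite horner_map horner_map hornerC.
Qed.

(** Differentiation in the first variable happens with the second one fixed;
    this reduces it to polynomials in one variable. *)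
Lemma ev2_slice a b p : ev2 a b p = ev1 a (map_poly (horner_eval b) p).
Proof.
rewrite -[LHS](horner_map (horner_eval b) p a%:P).
by rewrite /ev1 /= /horner_eval hornerC.
Qed.

End Evaluation.

(** [h k] stands for [1 / k]; it is a parameter because the coefficients are
    themselves polynomials when there are two variables. *)
Definition antideriv (K : comNzRingType) (h : nat -> K) (p : {poly K}) :
    {poly K} :=
  \poly_(k < (size p).+1) (h k * p`_k.-1 *+ (k != 0)%N).

Lemma coef_antideriv (K : comNzRingType) (h : nat -> K) (p : {poly K}) k :
  (antideriv h p)`_k = h k * p`_k.-1 *+ (k != 0)%N.
Proof.
rewrite coef_poly; case: k => [|k]; first by rewrite !mulr0n.
by rewrite ltnS; case: ltnP => // hk; rewrite nth_default // mulr0 mul0rn.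
Qed.

Lemma map_antideriv (K K' : comNzRingType) (f : {rmorphism K -> K'})
    (h : nat -> K) (h' : nat -> K') (p : {poly K}) :
  (forall k, f (h k) = h' k) ->
  map_poly f (antideriv h p) = antideriv h' (map_poly f p).
Proof.
move=> hh; apply/polyP => k; rewrite coef_map !coef_antideriv coef_map /=.
by case: k => [|k]; rewrite ?rmorph0 //= rmorphM hh.
Qed.

Lemma antiderivK (K : comNzRingType) (h : nat -> K) (p : {poly K}) :
  (forall k, h k.+1 *+ k.+1 = 1) -> (antideriv h p)^`() = p.
Proof.
move=> hh; apply/polyP => k; rewrite coef_deriv coef_poly ltnS /=.
case: ltnP => hk; last by rewrite mul0rn nth_default.
by rewrite mulr1n -mulrnAl hh mul1r.
Qed.

(** * Integration of polynomial families *)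

Section Integration.
Variable R : realType.
Local Notation C := R[i].

Lemma horner_deriv (I : set R) (p : {poly C}) (x : R) :
  clim (within I x^') (fun y => (p.[y%:C] - p.[x%:C]) / (y - x)%:C)
    (p^`()).[x%:C].
Proof.
have cy : clim (within I x^') (fun y => y%:C : C) x%:C.
  by apply: clim_real; do 2 apply: cvg_within_filter; exact: cvg_id.
elim/poly_ind: p => [|p c IH].
  rewrite deriv0 horner0.
  have h0 : clim (within I x^') (fun=> 0 : C) 0 by exact: clim_cst.
  by apply: clim_near h0; apply: nearW => y; rewrite !horner0 subrr mul0r.
have -> : (p * 'X + c%:P)^`().[x%:C] = p^`().[x%:C] * x%:C + p.[x%:C].
  by rewrite derivMXaddC hornerD hornerMX [RHS]addrC.
have cst : clim (within I x^') (fun=> p.[x%:C] : C) p.[x%:C] by exact: clim_cst.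
apply: clim_near (climD (climM IH cy) cst).
apply: filterS (near_within_neq I x) => y [_ yx].
have yx0 : (y - x)%:C != 0 :> C by rewrite (inj_eq (@complexI R)) subr_eq0.
rewrite !hornerMXaddC; move: yx0; rewrite rmorphB /=.
by move: (p.[y%:C]) (p.[x%:C]) (y%:C) (x%:C) => u v s t h; field.
Qed.

Definition inv_nat (k : nat) : C := k%:R^-1.

Lemma inv_natK k : inv_nat k.+1 *+ k.+1 = 1.
Proof. by rewrite /inv_nat -[LHS]mulr_natr mulVf // pnatr_eq0. Qed.

Definition ray : set R := [set y | 0 <= y].

Lemma integrate_polynomial p q (F : R -> 'M[C]_(p, q)) (P : 'M[{poly C}]_(p, q))
    (Q := map_mx (antideriv inv_nat) P) :
  (forall x, 0 <= x -> deriv_within ray F x (map_mx (ev1 x%:C) P)) ->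
  forall x, 0 <= x ->
    F x = map_mx (ev1 x%:C) Q + (F 0 - map_mx (ev1 (0 : R)%:C) Q).
Proof.
move=> hF x x0; apply/eqP; rewrite addrC -subr_eq; apply/eqP; apply/esym.
apply: (@deriv0_eq R ray _ _ (fun y => F y - map_mx (ev1 y%:C) Q) 0 x x0).
  by move=> y /andP[].
move=> y /andP[y0 _]; rewrite -(subrr (map_mx (ev1 y%:C) P)).
apply: derivD (hF _ y0) _; apply: derivN => i j.
have := @horner_deriv ray (antideriv inv_nat (P i j)) y.
rewrite antiderivK; last exact: inv_natK.
rewrite -/(clim _ _ _) !mxE; apply: clim_near; apply: nearW => s.
by rewrite !mxE.
Qed.

End Integration.

(** * Polynomiality of [Pi] and [S] *)

(** The derivative of [A ^+ k *m Pi] is a multiple of [A ^+ k.+1 *m Pi], which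
    vanishes for large [k]; so polynomiality descends to [k = 0]. *)
Lemma nilpotent_polymx (K : comNzRingType) (L : fieldType) (T : Type)
    (dom : T -> Prop) (ev : T -> {rmorphism K -> L}) n m (A : 'M[L]_n)
    (Pi : T -> 'M[L]_(n, m)) :
  A ^+ n = 0 ->
  (forall k, polymx dom ev (fun t => A ^+ k.+1 *m Pi t) ->
             polymx dom ev (fun t => A ^+ k *m Pi t)) ->
  polymx dom ev Pi.
Proof.
move=> An0 step.
have down k : (k <= n)%N -> polymx dom ev (fun t => A ^+ (n - k) *m Pi t).
  elim: k => [_|k IH kn].
    by exists 0 => t _; rewrite subn0 An0 mul0mx map_mx0.
  by apply: step; rewrite subnSK //; apply: IH; exact: ltnW.
have := down n (leqnn n); rewrite subnn.
by apply: polymx_eq => t _; rewrite expr0 mul1mx.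
Qed.

Section PolynomialSolutions.
Variable R : realType.
Local Notation C := R[i].

Definition dom1 (x : R) : Prop := 0 <= x.
Definition evR1 (x : R) := ev1 (x%:C : C).
Definition dom2 (u : R * R) : Prop := 0 <= u.1 /\ 0 <= u.2.
Definition evR2 (u : R * R) := ev2 (u.1%:C : C) (u.2%:C : C).

Lemma conj_horner (r : {poly C}) (x : R) :
  (map_poly Num.conj r).[x%:C] = (r.[x%:C])^*%R.
Proof.
have xx : (x%:C : C)^*%R = x%:C by exact: conjc_real.
by rewrite -{1}xx horner_map.
Qed.

Lemma conj_polymx1 p q (F : R -> 'M[C]_(p, q)) : polymx dom1 evR1 F ->
  polymx dom1 evR1 (fun x => ((F x)^t*)%sesqui).
Proof.
move=> [P hP]; exists (map_mx (map_poly Num.conj) P^T) => x x0.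
rewrite (hP _ x0); apply/matrixP => i j; rewrite !mxE.
exact/esym/conj_horner.
Qed.

Lemma conj_polymx2 p q (F : R * R -> 'M[C]_(p, q)) : polymx dom2 evR2 F ->
  polymx dom2 evR2 (fun x => ((F x)^t*)%sesqui).
Proof.
move=> [P hP]; exists (map_mx (map_poly (map_poly Num.conj)) P^T) => -[x t] dx.
rewrite (hP _ dx); apply/matrixP => i j; rewrite !mxE.
have inner (r : {poly {poly C}}) :
    (map_poly (map_poly Num.conj) r).[x%:C%:P] =
    map_poly Num.conj (r.[x%:C%:P]).
  have xx : map_poly Num.conj (x%:C%:P : {poly C}) = x%:C%:P.
    by rewrite map_polyC /=; congr _%:P; exact: conjc_real.
  by rewrite -{1}xx horner_map.
by rewrite /evR2 /ev2 /= /horner_eval inner conj_horner.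
Qed.

Lemma integral_polymx1 p q (F G : R -> 'M[C]_(p, q)) :
  (forall x : R, 0 <= x -> deriv_within (@ray R) F x (G x)) ->
  polymx dom1 evR1 G -> polymx dom1 evR1 F.
Proof.
move=> hF [P hP].
have hF' x : 0 <= x -> deriv_within (@ray R) F x (map_mx (ev1 x%:C) P).
  by move=> x0; have := hF x x0; rewrite (hP _ x0).
have FE := integrate_polynomial hF'.
have cst := polymx_cst dom1 (fun t c => ev1C (t%:C : C) c).
apply: polymx_eq (fun x x0 => esym (FE x x0)) _.
by apply: polymxD; [eexists | exact: cst].
Qed.

(** Antidifferentiation commutes with fixing [t]; so the antiderivatives of the
    slices at the various [t] are the slices of one polynomial. *)
Lemma integral_polymx2 p q (F G : R -> R -> 'M[C]_(p, q)) :
  (forall x t : R, 0 <= x -> 0 <= t ->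
    deriv_within (@ray R) (F^~ t) x (G x t)) ->
  polymx dom2 evR2 (fun u => G u.1 u.2) ->
  polymx dom1 evR1 (F 0) ->
  polymx dom2 evR2 (fun u => F u.1 u.2).
Proof.
move=> hF [P hP] [P0 hP0].
pose h k := (inv_nat R k)%:P.
pose Q := map_mx (antideriv h) P.
pose slice (t : R) := map_mx (map_poly (horner_eval (t%:C : C))).
have QE (x t : R) : map_mx (ev2 (x%:C : C) t%:C) Q =
    map_mx (ev1 x%:C) (map_mx (antideriv (inv_nat R)) (slice p q t P)).
  apply/matrixP => i j; rewrite !mxE ev2_slice; congr (ev1 _ _).
  by apply: map_antideriv => k; exact: hornerC.
(* The constant of integration is [F 0 t] minus the value of [Q] at [x = 0]. *)
exists (Q + map_mx polyC P0 - map_mx (fun r => (r.[0])%:P) Q) => -[x t] [/= x0 t0].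
have hF' y : 0 <= y ->
    deriv_within (@ray R) (F^~ t) y (map_mx (ev1 y%:C) (slice p q t P)).
  move=> y0; have := hF y t y0 t0; rewrite (hP (y, t) (conj y0 t0)).
  congr deriv_within; apply/matrixP => i j.
  by rewrite !mxE -ev2_slice.
rewrite (integrate_polynomial hF' x0) -!QE (hP0 _ t0) addrA.
rewrite map_mxB map_mxD; congr (_ + _ - _).
  by apply/matrixP => i j; rewrite !mxE; exact/esym/ev2_inner.
apply/matrixP => i j; rewrite !mxE; apply/esym.
apply: (etrans (ev2_inner _ _ _)).
by rewrite /ev2 /ev1 /= /horner_eval !rmorph0.
Qed.

Section Solutions.
Variables (m n : nat) (A : 'M[C]_n) (d b : 'rV[R]_m).
Hypothesis An0 : A ^+ n = 0.
Let D := rdiag d.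
Let B := rdiag b.

Let cst1 := polymx_cst dom1 (fun (t : R) c => ev1C (t%:C : C) c).

Lemma power_deriv (I : set R) (D0 : 'M[C]_m) (Pi : R -> 'M[C]_(n, m)) x k :
  deriv_within I Pi x (- ('i%C *: (A *m Pi x *m D0))) ->
  deriv_within I (fun y => A ^+ k *m Pi y) x
    (A ^+ k.+1 *m Pi x *m (- 'i%C *: D0)).
Proof.
move=> h; have := @mulmx_cst_deriv R I _ _ _ (A ^+ k) Pi x _ h.
congr deriv_within.
have -> : A ^+ k.+1 = A ^+ k *m A by rewrite exprSr.
by rewrite -scalemxAr mulmxN -scalemxAr scaleNr !mulmxA.
Qed.

Lemma Pi_polymx1 (Pi : R -> 'M[C]_(n, m)) :
  (forall x : R, 0 <= x ->
    deriv_within (@ray R) Pi x (- ('i%C *: (A *m Pi x *m D)))) ->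
  polymx dom1 evR1 Pi.
Proof.
move=> hPi; apply: (nilpotent_polymx An0) => k hk.
apply: (integral_polymx1 (G := fun x => A ^+ k.+1 *m Pi x *m (- 'i%C *: D))).
  by move=> x x0; apply: power_deriv; exact: hPi.
by apply: polymxM hk _; exact: cst1.
Qed.

Lemma S_polymx1 (Pi : R -> 'M[C]_(n, m)) (S : R -> 'M[C]_n) :
  system1 A B D Pi S -> polymx dom1 evR1 S.
Proof.
move=> h.
have hPi : polymx dom1 evR1 Pi by apply: Pi_polymx1 => x /h[].
apply: (integral_polymx1 (G := fun x => Pi x *m D *m B *m ((Pi x)^t*)%sesqui)).
  by move=> x /h[].
apply: polymxM (conj_polymx1 hPi); apply: polymxM; last exact: cst1.
by apply: polymxM hPi _; exact: cst1.
Qed.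

End Solutions.

Section Solutions2.
Variables (m n : nat) (A : 'M[C]_n) (d dh b : 'rV[R]_m).
Hypothesis An0 : A ^+ n = 0.
Let D := rdiag d.
Let Dh := rdiag dh.
Let B := rdiag b.
Variables (Pi : R -> R -> 'M[C]_(n, m)) (S : R -> R -> 'M[C]_n).
Hypothesis sys : system2 A B D Dh Pi S.

Let cst2 := polymx_cst dom2
  (fun (u : R * R) c => ev2C (u.1%:C : C) (u.2%:C : C) c).
Let cst1 := polymx_cst dom1 (fun (t : R) c => ev1C (t%:C : C) c).

Lemma Pi_polymx2 : polymx dom2 evR2 (fun u => Pi u.1 u.2).
Proof.
apply: (nilpotent_polymx An0) => k hk.
apply: (integral_polymx2 (F := fun x t => A ^+ k *m Pi x t)
    (G := fun x t => A ^+ k.+1 *m Pi x t *m (- 'i%C *: D))).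
- by move=> x t x0 t0; apply: power_deriv; case: sys => /(_ t t0 x x0)[].
- by apply: polymxM hk _; exact: cst2.
- apply: polymxM; first exact: cst1.
  by apply: (Pi_polymx1 (d := dh) An0) => t t0; case: sys => _ /(_ 0 (lexx 0) t t0)[].
Qed.

Lemma S_polymx2 : polymx dom2 evR2 (fun u => S u.1 u.2).
Proof.
apply: (integral_polymx2 (G := fun x t =>
    Pi x t *m D *m B *m ((Pi x t)^t*)%sesqui)).
- by move=> x t x0 t0; case: sys => /(_ t t0 x x0)[].
- apply: polymxM (conj_polymx2 Pi_polymx2); apply: polymxM; last exact: cst2.
  by apply: polymxM Pi_polymx2 _; exact: cst2.
- have sys0 : system1 A B Dh (Pi 0) (S 0) by case: sys => _; apply.
  exact: (@S_polymx1 m n A dh b An0 (Pi 0) (S 0) sys0).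
Qed.

End Solutions2.

End PolynomialSolutions.

(** * The transformed fundamental solution and wave function *)

Lemma cancel_middle (K : fieldType) m (w E u F c : 'M[K]_m) :
  u \in unitmx -> w *m E *m invmx u *m (u *m F *m c) = w *m (E *m F) *m c.
Proof.
by move=> uu; rewrite !mulmxA -[_ *m invmx u *m u]mulmxA mulVmx // mulmx1.
Qed.

Lemma mulmx_regroup (K : fieldType) m (w E F c : 'M[K]_m) :
  w *m (E *m F) *m c = w *m E *m (F *m c).
Proof. by rewrite !mulmxA. Qed.

Section Dressing.
Variable R : realType.
Local Notation C := R[i].
Variables (m n : nat) (A : 'M[C]_n) (b : 'rV[R]_m).
Hypothesis An0 : A ^+ n = 0.
Let B := rdiag b.

Lemma system1_identity (d : 'rV[R]_m) (Pi : R -> 'M[C]_(n, m))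
    (S : R -> 'M[C]_n) (x : R) :
  system1 A B (rdiag d) Pi S -> 0 <= x ->
  node_identity A b (Pi 0) (S 0) -> node_identity A b (Pi x) (S x).
Proof.
move=> h x0.
apply: (@node_identity_propagates R m n A d b (@ray R) Pi S _ _ 0 x x0).
- by move=> y /h[].
- by move=> y /h[].
- by move=> y /andP[].
Qed.

Lemma nilpotent_darboux_unit (P : 'M[C]_(n, m)) (T : 'M[C]_n) (z : C) :
  node_identity A b P T -> T \in unitmx -> z != 0 ->
  darboux A B P T z \in unitmx.
Proof.
move=> idT uT z0; apply: darboux_unit => //.
  exact: nilpotent_sub_unit.
by apply: nilpotent_sub_unit => //; rewrite conjC_eq0.
Qed.

Lemma nilpotent_darboux_deriv (d : 'rV[R]_m) (I : set R)
    (Pi : R -> 'M[C]_(n, m)) (S : R -> 'M[C]_n) (z : C) (x : R) :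
  (forall s, I s -> 0 <= s) -> system1 A B (rdiag d) Pi S ->
  (forall s, I s -> S s \in unitmx) -> node_identity A b (Pi 0) (S 0) ->
  z != 0 -> I x ->
  deriv_within I (fun y => darboux A B (Pi y) (S y) z) x
    (('i%C * z *: rdiag d - commutator (rdiag d) (rho_tilde B (Pi x) (S x)))
       *m darboux A B (Pi x) (S x) z
     - darboux A B (Pi x) (S x) z
       *m diag_mx ('i%C * z *: map_mx (real_complex R) d)).
Proof.
move=> I0 h uS id0 z0 Ix; rewrite diag_spectral.
have sub : I `<=` [set y | 0 <= y] by move=> y /I0.
apply: (@darboux_deriv R m n A d b I Pi S).
- by move=> y /I0 y0; apply: deriv_sub sub _; case: (h y y0).
- by move=> y /I0 y0; apply: deriv_sub sub _; case: (h y y0).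
- exact: uS.
- by move=> y /I0 y0; exact: system1_identity h y0 id0.
- exact: Ix.
- exact: nilpotent_sub_unit.
Qed.

Lemma fundamental_solution_dressed (d : 'rV[R]_m) (Pi : R -> 'M[C]_(n, m))
    (S : R -> 'M[C]_n) (z : C)
    (w := fun x => darboux A B (Pi x) (S x) z) :
  node_identity A b (Pi 0) (S 0) -> system1 A B (rdiag d) Pi S ->
  (forall x, 0 <= x -> S x \in unitmx) -> z != 0 ->
  w 0 \in unitmx /\
  forall W, fundamental_solution (rdiag d)
      (fun x => rho_tilde B (Pi x) (S x)) z W <->
    forall x, 0 <= x ->
      W x = w x *m mxexp ('i%C * z * x%:C *: rdiag d) *m invmx (w 0).
Proof.
move=> id0 sys uS z0.
have uw x : 0 <= x -> w x \in unitmx.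
  move=> x0; apply: nilpotent_darboux_unit z0; last exact: uS.
  exact: system1_identity sys x0 id0.
have u0 : w 0 \in unitmx by apply: uw.
pose v := 'i%C * z *: map_mx (real_complex R) d.
pose M x := 'i%C * z *: rdiag d -
  commutator (rdiag d) (rho_tilde B (Pi x) (S x)).
have hw x : (@ray R) x ->
    deriv_within (@ray R) w x (M x *m w x - w x *m diag_mx v).
  move=> x0; apply: (nilpotent_darboux_deriv (I := @ray R) _ sys uS id0 z0 x0).
  by move=> s.
split; first exact: u0.
move=> W; split=> [[W0 hW] x x0|hW].
  rewrite mxexp_rdiag -/v -[RHS]mulmx1 -W0.
  by apply: (solution_dressed hw uw x0) => // y /andP[].
split=> [|x x0].
  by rewrite hW // mxexp_rdiag expz0 mulmx1 mulmxV.
rewrite hW // mxexp_rdiag -/v -/(M x).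
apply: (deriv_ext (D := @ray R) x0 _
  (@dressed_deriv R m (@ray R) v M w hw (invmx (w 0)) x x0)) => y y0.
by rewrite hW // mxexp_rdiag.
Qed.

(** The formula holds along the segment from [(0, 0)] to [(0, t)] and then along
    the one from [(0, t)] to [(x, t)]; the factors [w 0 t] cancel.  Conversely,
    the two exponentials commute, so either of them can be put next to [w x t]
    to differentiate in the variable that it carries. *)
Lemma wave_function_dressed (d dh : 'rV[R]_m) (Pi : R -> R -> 'M[C]_(n, m))
    (S : R -> R -> 'M[C]_n) (eps : R) (z : C)
    (w := fun x t => darboux A B (Pi x t) (S x t) z) :
  node_identity A b (Pi 0 0) (S 0 0) ->
  system2 A B (rdiag d) (rdiag dh) Pi S -> 0 < eps ->
  (forall x t, 0 <= x -> 0 <= t <= eps -> S x t \in unitmx) -> z != 0 ->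
  w 0 0 \in unitmx /\
  forall W, wave_function (rdiag d) (rdiag dh)
      (fun x t => rho_tilde B (Pi x t) (S x t)) eps z W <->
    forall x t, 0 <= x -> 0 <= t <= eps ->
      W x t = w x t
        *m mxexp ('i%C * z *: (x%:C *: rdiag d + t%:C *: rdiag dh))
        *m invmx (w 0 0).
Proof.
move=> id0 [sysx syst] eps0 uS z0.
have idx x : 0 <= x -> node_identity A b (Pi x 0) (S x 0).
  by move=> x0; exact: system1_identity (sysx 0 (lexx 0)) x0 id0.
have idt t : 0 <= t -> node_identity A b (Pi 0 t) (S 0 t).
  by move=> t0; exact: system1_identity (syst 0 (lexx 0)) t0 id0.
have idxt x t : 0 <= x -> 0 <= t -> node_identity A b (Pi x t) (S x t).
  by move=> x0 t0; exact: system1_identity (syst x x0) t0 (idx x x0).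
have uw x t : 0 <= x -> 0 <= t <= eps -> w x t \in unitmx.
  move=> x0 t0; apply: nilpotent_darboux_unit z0; last exact: uS.
  by apply: idxt => //; case/andP: t0.
have eps00 : 0 <= (0 : R) <= eps by rewrite lexx ltW.
have u0 : w 0 0 \in unitmx by apply: uw.
pose v := 'i%C * z *: map_mx (real_complex R) d.
pose vh := 'i%C * z *: map_mx (real_complex R) dh.
have E2 (x t : R) : mxexp ('i%C * z *: (x%:C *: rdiag d + t%:C *: rdiag dh)) =
    expz v x *m expz vh t := mxexp_rdiag2 d dh ('i%C * z) x t.
pose M x t := 'i%C * z *: rdiag d -
  commutator (rdiag d) (rho_tilde B (Pi x t) (S x t)).
pose Mh x t := 'i%C * z *: rdiag dh -
  commutator (rdiag dh) (rho_tilde B (Pi x t) (S x t)).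
pose band : set R := [set s | 0 <= s <= eps].
have hwx x t : band t -> (@ray R) x ->
    deriv_within (@ray R) (w^~ t) x (M x t *m w x t - w x t *m diag_mx v).
  move=> t0; have /andP[t0' _] : 0 <= t <= eps by exact: t0.
  move=> x0; apply: (nilpotent_darboux_deriv (I := @ray R) _ (sysx t t0')
    (fun s s0 => uS s t s0 t0) (idt t t0') z0 x0).
  by move=> s.
have hwt x t : 0 <= x -> band t ->
    deriv_within band (w x) t (Mh x t *m w x t - w x t *m diag_mx vh).
  move=> x0 t0; apply: (nilpotent_darboux_deriv (I := band) _ (syst x x0)
    (fun s s0 => uS x s x0 s0) (idx x x0) z0 t0).
  by move=> s /andP[].
clearbody v vh w.
split; first exact: u0.
move=> W; split=> [[W0 hW] x t x0 t0|hW].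
  have /andP[t0' te] := t0.
  have Wx : W x t = w x t *m expz v x *m invmx (w 0 t) *m W 0 t.
    apply: (@solution_dressed R m (@ray R) v (M^~ t) (w^~ t)
      (fun s s0 => hwx s t t0 s0) (fun s s0 => uw s t s0 t0) (W^~ t) x x0).
      by move=> y /andP[].
    by move=> s s0; exact: (proj1 (hW s t s0 t0)).
  have Wt : W 0 t = w 0 t *m expz vh t *m invmx (w 0 0) *m W 0 0.
    apply: (@solution_dressed R m band vh (Mh 0) (w 0)
      (fun s s0 => hwt 0 s (lexx 0) s0) (fun s s0 => uw 0 s (lexx 0) s0)
      (W 0) t t0').
      by move=> y /andP[y0 yt]; apply/andP; split=> //; exact: le_trans te.
    by move=> s s0; exact: (proj2 (hW 0 s (lexx 0) s0)).
  rewrite E2 Wx Wt W0 (mulmx1 (_ *m invmx (w 0 0))).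
  exact: cancel_middle (uw 0 t (lexx 0) t0).
have Wx x t : 0 <= x -> 0 <= t <= eps ->
    W x t = w x t *m expz v x *m (expz vh t *m invmx (w 0 0)).
  by move=> x0 t0; rewrite -mulmx_regroup -E2; exact: hW.
have Wt x t : 0 <= x -> 0 <= t <= eps ->
    W x t = w x t *m expz vh t *m (expz v x *m invmx (w 0 0)).
  by move=> x0 t0; rewrite -mulmx_regroup -expzC -E2; exact: hW.
split=> [|x t x0 t0].
  by rewrite Wx // !expz0 mulmx1 mul1mx mulmxV.
split; first rewrite Wx //; last rewrite Wt //.
  apply: (deriv_ext (D := @ray R) x0 _ (@dressed_deriv R m (@ray R) v (M^~ t)
    (w^~ t) (fun s s0 => hwx s t t0 s0) (expz vh t *m invmx (w 0 0)) x x0)) => y y0.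
  by rewrite Wx.
apply: (deriv_ext (D := band) t0 _ (@dressed_deriv R m band vh (Mh x) (w x)
  (fun s s0 => hwt x s x0 s0) (expz v x *m invmx (w 0 0)) t t0)) => y y0.
by rewrite Wt.
Qed.

End Dressing.

(** * Polynomial form of the Darboux matrix *)

Section Conclusions.
Variable R : realType.
Local Notation C := R[i].

Lemma mxeval1E p q (P : 'M[{poly C}]_(p, q)) (a : C) :
  mxeval1 P a = map_mx (ev1 a) P.
Proof. by apply/matrixP => i j; rewrite !mxE. Qed.

Lemma mxeval2E p q (P : 'M[{poly {poly C}}]_(p, q)) (a c : C) :
  mxeval2 P a c = map_mx (ev2 a c) P.
Proof. by apply/matrixP => i j; rewrite !mxE. Qed.

Lemma mxeval3E p q (P : 'M[{poly {poly {poly C}}}]_(p, q)) (a c e : C) :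
  mxeval3 P a c e = map_mx (ev3 a c e) P.
Proof. by apply/matrixP => i j; rewrite !mxE. Qed.

Variables (m n : nat) (A : 'M[C]_n) (b : 'rV[R]_m).
Hypothesis An0 : A ^+ n = 0.
Let B := rdiag b.

Lemma darboux_polymx1 (Pi : R -> 'M[C]_(n, m)) (S : R -> 'M[C]_n) :
  polymx (@dom1 R) (@evR1 R) Pi -> polymx (@dom1 R) (@evR1 R) S ->
  exists P, forall x z, 0 <= x -> S x \in unitmx -> z != 0 ->
    darboux A B (Pi x) (S x) z = (\det (S x))^-1 *: mxeval2 P x%:C z^-1.
Proof.
move=> hPi hS.
pose dom (u : R * C) := 0 <= u.1 /\ u.2 != 0.
pose ev (u : R * C) := ev2 (u.1%:C : C) u.2^-1.
have lift p q (F : R -> 'M[C]_(p, q)) : polymx (@dom1 R) (@evR1 R) F ->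
    polymx dom ev (fun u => F u.1).
  move=> [P hP]; exists (map_mx (map_poly polyC) P) => u [u0 _].
  rewrite (hP _ u0); apply/matrixP => i j; rewrite !mxE.
  exact/esym/ev2_outer.
(* The inner variable ['X%:P] evaluates to [1 / z]. *)
have [|u [_ uz]|P hP] := darboux_polymx (fun u c => ev2C (u.1%:C : C) u.2^-1 c)
  B (lift _ _ _ hPi) (lift _ _ _ (conj_polymx1 hPi)) (lift _ _ _ hS) 'i%C
  (z := snd) (zeta := 'X%:P) An0.
- by move=> u [].
- by rewrite /ev ev2_inner /ev1 /= /horner_eval hornerX.
by exists P => x z x0 uS z0; rewrite mxeval2E; exact: (hP (x, z)).
Qed.

Lemma darboux_polymx2 (Pi : R -> R -> 'M[C]_(n, m)) (S : R -> R -> 'M[C]_n) :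
  polymx (@dom2 R) (@evR2 R) (fun u => Pi u.1 u.2) ->
  polymx (@dom2 R) (@evR2 R) (fun u => S u.1 u.2) ->
  exists P, forall x t z, 0 <= x -> 0 <= t -> S x t \in unitmx -> z != 0 ->
    darboux A B (Pi x t) (S x t) z =
    (\det (S x t))^-1 *: mxeval3 P x%:C t%:C z^-1.
Proof.
move=> hPi hS.
pose dom (u : R * R * C) := @dom2 R u.1 /\ u.2 != 0.
pose ev (u : R * R * C) := ev3 (u.1.1%:C : C) u.1.2%:C u.2^-1.
have lift p q (F : R * R -> 'M[C]_(p, q)) : polymx (@dom2 R) (@evR2 R) F ->
    polymx dom ev (fun u => F u.1).
  move=> [P hP]; exists (map_mx (map_poly (map_poly polyC)) P) => u [u0 _].
  rewrite (hP _ u0); apply/matrixP => i j; rewrite !mxE.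
  exact/esym/ev3_outer.
have [|u [_ uz]|P hP] := darboux_polymx
  (fun u c => ev3C (u.1.1%:C : C) u.1.2%:C u.2^-1 c)
  B (lift _ _ _ hPi) (lift _ _ _ (conj_polymx2 hPi)) (lift _ _ _ hS) 'i%C
  (z := snd) (zeta := 'X%:P%:P) An0.
- by move=> u [].
- by rewrite /ev /ev3 /= /horner_eval !hornerC hornerX.
exists P => x t z x0 t0 uS z0; rewrite mxeval3E.
by apply: (hP ((x, t), z)).
Qed.

End Conclusions.

Theorem proposition3p3 (R : realType) (m n : nat) (d dh b : 'rV[R]_m)
    (A : 'M[R[i]]_n)
    (hb : forall k, b 0 k = 1 \/ b 0 k = -1)
    (hA : forall a : R[i], eigenvalue A a <-> a = 0) :
  let D := rdiag d in
  let Dh := rdiag dh in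
  let B := rdiag b in
  (forall (Pi : R -> 'M[R[i]]_(n, m)) (S : R -> 'M[R[i]]_n),
    admissible_init A B (Pi 0) (S 0) ->
    system1 A B D Pi S ->
    let rho := fun x => rho_tilde B (Pi x) (S x) in
    let wA := fun x z => darboux A B (Pi x) (S x) z in
    [/\ (exists P, forall x, 0 <= x -> Pi x = mxeval1 P x%:C) /\
        (exists P, forall x, 0 <= x -> S x = mxeval1 P x%:C),
        (exists q : {poly R[i]}, forall x, 0 <= x -> \det (S x) = q.[x%:C]) /\
        (exists p, forall x, 0 <= x -> S x \in unitmx ->
          rho x = (\det (S x))^-1 *: mxeval1 p x%:C),
        (exists P, forall x z, 0 <= x -> S x \in unitmx -> z != 0 ->
          wA x z = (\det (S x))^-1 *: mxeval2 P x%:C z^-1)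
      & (forall x, 0 <= x -> \det (S x) != 0) ->
        forall z, z != 0 ->
          wA 0 z \in unitmx /\
          forall W, fundamental_solution D rho z W <->
            forall x, 0 <= x ->
              W x = wA x z *m mxexp ('i%C * z * x%:C *: D) *m invmx (wA 0 z)]) /\
  (forall (Pi : R -> R -> 'M[R[i]]_(n, m)) (S : R -> R -> 'M[R[i]]_n),
    admissible_init A B (Pi 0 0) (S 0 0) ->
    system2 A B D Dh Pi S ->
    let rho := fun x t => rho_tilde B (Pi x t) (S x t) in
    let wA := fun x t z => darboux A B (Pi x t) (S x t) z in
    [/\ (exists P, forall x t, 0 <= x -> 0 <= t ->
          Pi x t = mxeval2 P x%:C t%:C) /\
        (exists P, forall x t, 0 <= x -> 0 <= t ->
          S x t = mxeval2 P x%:C t%:C),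
        (exists q : {poly {poly R[i]}}, forall x t, 0 <= x -> 0 <= t ->
          \det (S x t) = q.[x%:C%:P].[t%:C]) /\
        (exists p, forall x t, 0 <= x -> 0 <= t -> S x t \in unitmx ->
          rho x t = (\det (S x t))^-1 *: mxeval2 p x%:C t%:C),
        (exists P, forall x t z, 0 <= x -> 0 <= t -> S x t \in unitmx ->
          z != 0 ->
          wA x t z = (\det (S x t))^-1 *: mxeval3 P x%:C t%:C z^-1)
      & forall eps, 0 < eps ->
        (forall x t, 0 <= x -> 0 <= t <= eps -> \det (S x t) != 0) ->
        forall z, z != 0 ->
          wA 0 0 z \in unitmx /\
          forall W, wave_function D Dh rho eps z W <->
            forall x t, 0 <= x -> 0 <= t <= eps ->
              W x t = wA x t z
                *m mxexp ('i%C * z *: (x%:C *: D + t%:C *: Dh))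
                *m invmx (wA 0 0 z)]).
Proof.
move=> D Dh B.
have An0 : A ^+ n = 0 by apply: nilpotent_eigenvalue => a /hA.
split=> [Pi S [_ id0] sys rho wA|Pi S [_ id0] sys rho wA].
  have hPi : polymx (@dom1 R) (@evR1 R) Pi by apply: (Pi_polymx1 (d := d) An0) => x /sys[].
  have hS : polymx (@dom1 R) (@evR1 R) S := @S_polymx1 R m n A d b An0 Pi S sys.
  split.
  - by split; [case: hPi => P hP | case: hS => P hP]; exists P => x x0;
      rewrite mxeval1E; exact: hP.
  - split; first exact: polymx_det hS.
    have [p hp] := rho_polymx (fun (t : R) c => ev1C (t%:C : R[i]) c) B hPi
      (conj_polymx1 hPi) hS.
    by exists p => x x0 uS; rewrite mxeval1E; exact: hp.
  - exact: darboux_polymx1.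
  - move=> detS z z0; apply: (fundamental_solution_dressed An0 id0 sys _ z0).
    by move=> x x0; rewrite unitmxE unitfE; exact: detS.
have hPi := @Pi_polymx2 R m n A d dh b An0 Pi S sys.
have hS := @S_polymx2 R m n A d dh b An0 Pi S sys.
split.
- by split; [case: hPi => P hP | case: hS => P hP]; exists P => x t x0 t0;
    rewrite mxeval2E; exact: (hP (x, t) (conj x0 t0)).
- split.
    have [q hq] := polymx_det hS.
    by exists q => x t x0 t0; exact: (hq (x, t) (conj x0 t0)).
  have [p hp] := rho_polymx
    (fun (u : R * R) c => ev2C (u.1%:C : R[i]) (u.2%:C : R[i]) c) B hPi
    (conj_polymx2 hPi) hS.
  by exists p => x t x0 t0 uS; rewrite mxeval2E; exact: (hp (x, t) (conj x0 t0)).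
- exact: darboux_polymx2.
- move=> eps eps0 detS z z0.
  apply: (wave_function_dressed An0 id0 sys eps0 _ z0).
  by move=> x t x0 t0; rewrite unitmxE unitfE; exact: detS.
Qed.
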